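(* Let $k$ be a field and $A$ an affine cellular $k$-algebra with cell chain $$0=J_{-1}\subset J_0\subset\cdots\subset J_n=A,$$ such that $J_j/J_{j-1}\simeq(M_{m_j}(B_j),\psi_j)$ for $0\le j\le n$, with cell data $B_j$, $m_j$, $\psi_j$. Suppose that $B_j$ is reduced and $\det(\psi_j)$ is not a zero divisor in $B_j$ for all $j$. Let $m$ be the least non-negative integer with $\mathrm{r.ann}_{A/J_{m-1}}(J_m/J_{m-1})=0$. Then $$\mathrm{GKdim}(A)\le\max\left(\mathrm{Kdim}(B_0),\ldots,\mathrm{Kdim}(B_m)\right).$$ If $J_l/J_{l-1}$ is a finitely generated left $A/J_{l-1}$-module for all $l\le m$, then equality holds.
   Context: $\mathrm{GKdim}$ denotes Gelfand-Kirillov dimension over $k$ and $\mathrm{Kdim}$ Krull dimension. $\mathrm{r.ann}_R(X)=\{a\in R\mid xa=0\ \forall x\in X\}$. For a commutative ring $B$ and $\psi\in M_r(B)$, $(M_r(B),\psi)$ denotes the additive group of $M_r(B)$ with multiplication $a*b=a\psi b$. Affine cell ideals: let $A$ be a unital $k$-algebra with a $k$-involution $i$ ($k$-linear anti-automorphism with $i^2=\mathrm{id}$). A two-sided ideal $J$ is an affine cell ideal if: (1) $i(J)=J$; (2) there are a free $k$-module $V$ of finite rank $r\ge1$ and an affine (finitely generated) commutative unital $k$-algebra $B$ with a $k$-involution $\sigma$ such that $\Delta:=V\otimes_kB$ is an $A$-$B$-bimodule, with right $B$-structure induced by $B_B$; (3) there is an $A$-$A$-bimodule isomorphism $\alpha:J\to\Delta\otimes_B\Delta'$,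 where $\Delta'=B\otimes_kV$ is the $B$-$A$-bimodule with left $B$-structure induced by ${}_BB$ and right $A$-structure $(b\otimes v)a:=\tau(i(a)(v\otimes b))$, $\tau:\Delta\to\Delta'$ being the flip, such that $\alpha\circ i=\theta\circ\alpha$ with $\theta(v_1\otimes b_1\otimes_Bb_2\otimes v_2)=v_2\otimes\sigma(b_2)\otimes_B\sigma(b_1)\otimes v_1$. Identify $\Delta\otimes_B\Delta'$ with $V\otimes_kB\otimes_kV$ and fix a basis $v_1,\dots,v_r$ of $V$. Then there is a matrix $\psi=(\psi_{st})\in M_r(B)$ such that the multiplication of $J$, transported via $\alpha$, is $(v_i\otimes b\otimes v_j)(v_s\otimes c\otimes v_t)=v_i\otimes b\psi_{js}c\otimes v_t$, so that $J\simeq(M_r(B),\psi)$ as rings via $v_i\otimes b\otimes v_j\mapsto bE_{ij}$. The cell data of $J$ are $B$, $r$, $\psi$. Affine cellular algebras: a unital $k$-algebra $A$ with $k$-involution $i$ is affine cellular if there is a $k$-module decomposition $A=J_0'\oplus\cdots\oplus J_n'$ with $i(J_j')=J_j'$ such that $J_j=\bigoplus_{l\le j}J_l'$ gives a chain of two-sided ideals $0=J_{-1}\subset J_0\subset\cdots\subset J_n=A$ (a cell chain) and each $J_j/J_{j-1}$ is an affine cell ideal of $A/J_{j-1}$ with respect to the induced involution. *)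

(* Defs.v *)
From HB Require Import structures.
From mathcomp Require Import all_boot all_order all_algebra ring_quotient.
From mathcomp Require Import all_classical all_reals all_analysis.

Set Implicit Arguments.
Unset Strict Implicit.
Unset Printing Implicit Defensive.

Import Order.TTheory GRing.Theory Num.Theory.
Local Open Scope classical_set_scope.
Local Open Scope ring_scope.
Local Open Scope quotient_scope.

(* Associative unital k-algebras are [algType k] and commutative ones are
   [comAlgType k]; in both, 1 != 0. *)

Section Ideals.
Variable A : nzRingType.

Definition is_ideal (J : set A) : Prop :=
  [/\ J 0, forall x y, J x -> J y -> J (x - y),
      forall a x, J x -> J (a * x) & forall a x, J x -> J (x * a)].

Record properIdeal := ProperIdeal {
  in_ideal : set A;
  properIdealP : is_ideal in_ideal;
  properIdeal_neq1 : ~ in_ideal 1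
}.

Definition r_ann (X : set A) : set A := [set a | forall x, X x -> x * a = 0].

Definition fg_left_module (J : set A) : Prop :=
  exists (d : nat) (g : 'I_d -> A), (forall s, J (g s)) /\
    (forall x, J x -> exists a : 'I_d -> A, x = \sum_(s < d) a s * g s).

End Ideals.

(* The quotient algebra A / I, on top of the library's quotient of an additive
   group; [ring_quotient] gives the ring structure in the commutative case
   only. *)
Section QuotientAlgebra.
Variables (k : fieldType) (A : algType k) (I : properIdeal A).

Definition ideal_pred (x : A) : bool := `[< in_ideal I x >].

Lemma ideal_predE x : (x \in ideal_pred) = `[< in_ideal I x >].
Proof. by []. Qed.

Fact ideal_pred_zmod_closed : zmod_closed ideal_pred.
Proof.
have [I0 IB _ _] := properIdealP I.
split; first exact/asboolP.
by move=> x y /asboolP Ix /asboolP Iy; apply/asboolP/IB.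
Qed.

HB.instance Definition _ :=
  GRing.isZmodClosed.Build A ideal_pred ideal_pred_zmod_closed.

Fact ideal_pred_mull a x : x \in ideal_pred -> a * x \in ideal_pred.
Proof.
by have [_ _ IM _] := properIdealP I; move=> /asboolP Ix; apply/asboolP/IM.
Qed.

Fact ideal_pred_mulr a x : x \in ideal_pred -> x * a \in ideal_pred.
Proof.
by have [_ _ _ IM] := properIdealP I; move=> /asboolP Ix; apply/asboolP/IM.
Qed.

Definition ideal_zmod : zmodClosed A :=
  GRing.ZmodClosed.clone A ideal_pred _.

Definition quotAlg := Quotient.quot ideal_zmod.

HB.instance Definition _ := GRing.Zmodule.on quotAlg.

Definition quotAlg_pi (x : A) : quotAlg := \pi_(Quotient.quot ideal_zmod) x.
Definition quotAlg_repr (q : quotAlg) : A :=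
  repr (q : Quotient.quot ideal_zmod).

Lemma quotAlg_reprK : cancel quotAlg_repr quotAlg_pi.
Proof. by move=> q; apply: reprK. Qed.

Lemma quotAlg_piP x y : quotAlg_pi x = quotAlg_pi y <-> in_ideal I (x - y).
Proof.
split=> [/eqP|/asboolP Ixy]; last by apply/eqP; rewrite -Quotient.idealrBE.
by rewrite -Quotient.idealrBE => /asboolP.
Qed.

Lemma quotAlg_piD x y : quotAlg_pi (x + y) = quotAlg_pi x + quotAlg_pi y.
Proof. exact: (Quotient.pi_add ideal_zmod). Qed.

Lemma quotAlg_pi0 : quotAlg_pi 0 = 0.
Proof. by rewrite /quotAlg_pi piE. Qed.

Definition quotAlg_one : quotAlg := quotAlg_pi 1.
Definition quotAlg_mul (p q : quotAlg) : quotAlg :=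
  quotAlg_pi (quotAlg_repr p * quotAlg_repr q).
Definition quotAlg_scale (c : k) (q : quotAlg) : quotAlg :=
  quotAlg_pi (c *: quotAlg_repr q).

Fact quotAlg_repr_pi x : ideal_pred (quotAlg_repr (quotAlg_pi x) - x).
Proof. by apply/asboolP/quotAlg_piP; rewrite quotAlg_reprK. Qed.

Lemma quotAlg_piM_subproof x y :
  quotAlg_mul (quotAlg_pi x) (quotAlg_pi y) = quotAlg_pi (x * y).
Proof.
apply/quotAlg_piP/asboolP.
rewrite -[X in X - _](subrK (quotAlg_repr (quotAlg_pi x) * y)) -mulrBr.
rewrite -addrA -mulrBl; apply: (@rpredD _ ideal_zmod).
  exact/ideal_pred_mull/quotAlg_repr_pi.
exact/ideal_pred_mulr/quotAlg_repr_pi.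
Qed.

Lemma quotAlg_piZ_subproof c x :
  quotAlg_scale c (quotAlg_pi x) = quotAlg_pi (c *: x).
Proof.
apply/quotAlg_piP/asboolP; rewrite -scalerBr -mulr_algl.
exact/ideal_pred_mull/quotAlg_repr_pi.
Qed.

Fact quotAlg_mulA : associative quotAlg_mul.
Proof.
move=> p q r; rewrite -[p]quotAlg_reprK -[q]quotAlg_reprK -[r]quotAlg_reprK.
by rewrite !quotAlg_piM_subproof mulrA.
Qed.

Fact quotAlg_mul1q : left_id quotAlg_one quotAlg_mul.
Proof.
by move=> p; rewrite -[p]quotAlg_reprK quotAlg_piM_subproof mul1r.
Qed.

Fact quotAlg_mulq1 : right_id quotAlg_one quotAlg_mul.
Proof.
by move=> p; rewrite -[p]quotAlg_reprK quotAlg_piM_subproof mulr1.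
Qed.

Fact quotAlg_mulDl : left_distributive quotAlg_mul +%R.
Proof.
move=> p q r; rewrite -[p]quotAlg_reprK -[q]quotAlg_reprK -[r]quotAlg_reprK.
by rewrite -quotAlg_piD !quotAlg_piM_subproof -quotAlg_piD mulrDl.
Qed.

Fact quotAlg_mulDr : right_distributive quotAlg_mul +%R.
Proof.
move=> p q r; rewrite -[p]quotAlg_reprK -[q]quotAlg_reprK -[r]quotAlg_reprK.
by rewrite -quotAlg_piD !quotAlg_piM_subproof -quotAlg_piD mulrDr.
Qed.

Fact quotAlg_1neq0 : quotAlg_one != 0.
Proof.
apply/eqP; rewrite -quotAlg_pi0 => /quotAlg_piP; rewrite subr0.
exact: properIdeal_neq1.
Qed.

HB.instance Definition _ := GRing.Zmodule_isNzRing.Build quotAlg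
  quotAlg_mulA quotAlg_mul1q quotAlg_mulq1 quotAlg_mulDl quotAlg_mulDr
  quotAlg_1neq0.

Fact quotAlg_scaleA c d q :
  quotAlg_scale c (quotAlg_scale d q) = quotAlg_scale (c * d) q.
Proof.
by rewrite -[q]quotAlg_reprK !quotAlg_piZ_subproof scalerA.
Qed.

Fact quotAlg_scale1 : left_id 1 quotAlg_scale.
Proof.
by move=> q; rewrite -[q]quotAlg_reprK quotAlg_piZ_subproof scale1r.
Qed.

Fact quotAlg_scaleDr : right_distributive quotAlg_scale +%R.
Proof.
move=> c p q; rewrite -[p]quotAlg_reprK -[q]quotAlg_reprK.
by rewrite -quotAlg_piD !quotAlg_piZ_subproof -quotAlg_piD scalerDr.
Qed.

Fact quotAlg_scaleDl q : {morph quotAlg_scale^~ q : c d / c + d}.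
Proof.
move=> c d; rewrite -[q]quotAlg_reprK.
by rewrite !quotAlg_piZ_subproof -quotAlg_piD scalerDl.
Qed.

HB.instance Definition _ := GRing.Zmodule_isLmodule.Build k quotAlg
  quotAlg_scaleA quotAlg_scale1 quotAlg_scaleDr quotAlg_scaleDl.

Lemma quotAlg_piM x y : quotAlg_pi (x * y) = quotAlg_pi x * quotAlg_pi y.
Proof. by rewrite -quotAlg_piM_subproof. Qed.

Lemma quotAlg_pi1 : quotAlg_pi 1 = 1.
Proof. by []. Qed.

Lemma quotAlg_piZ c x : quotAlg_pi (c *: x) = c *: quotAlg_pi x.
Proof. by rewrite -quotAlg_piZ_subproof. Qed.

Fact quotAlg_scaleAl (c : k) (p q : quotAlg) : c *: (p * q) = (c *: p) * q.
Proof.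
rewrite -[p]quotAlg_reprK -[q]quotAlg_reprK.
by rewrite -quotAlg_piM -!quotAlg_piZ -quotAlg_piM scalerAl.
Qed.

HB.instance Definition _ :=
  GRing.Lmodule_isLalgebra.Build k quotAlg quotAlg_scaleAl.

Fact quotAlg_scaleAr (c : k) (p q : quotAlg) : c *: (p * q) = p * (c *: q).
Proof.
rewrite -[p]quotAlg_reprK -[q]quotAlg_reprK.
by rewrite -quotAlg_piM -!quotAlg_piZ -quotAlg_piM scalerAr.
Qed.

HB.instance Definition _ :=
  GRing.Lalgebra_isAlgebra.Build k quotAlg quotAlg_scaleAr.

(* Independent of the representative when [i] is additive and maps I into
   itself; see [quotAlg_invE]. *)
Definition quotAlg_inv (i : A -> A) (q : quotAlg) : quotAlg :=
  quotAlg_pi (i (quotAlg_repr q)).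

Lemma quotAlg_invE (i : {additive A -> A}) x :
  (forall y, in_ideal I y -> in_ideal I (i y)) ->
  quotAlg_inv i (quotAlg_pi x) = quotAlg_pi (i x).
Proof.
move=> Ii; apply/quotAlg_piP; rewrite -raddfB; apply: Ii.
exact/asboolP/quotAlg_repr_pi.
Qed.

End QuotientAlgebra.

Definition k_involution (k : fieldType) (A : algType k) (i : A -> A) : Prop :=
  [/\ linear i, {morph i : x y / x * y >-> y * x} & involutive i].

Definition affine_algebra (k : fieldType) (B : comAlgType k) : Prop :=
  exists s : seq B, forall S : subalgClosed B,
    (forall x, x \in s -> x \in S) -> forall b, b \in S.

Definition reduced (B : nzRingType) : Prop :=
  forall (b : B) (n : nat), b ^+ n = 0 -> b = 0.

(* A basis v_1, ..., v_r identifies V with k^r. Then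
     Delta = V (x)_k B                  is 'cV[B]_r, v_s (x) b |-> b e_s,
     Delta' = B (x)_k V                 is 'rV[B]_r,
     Delta (x)_B Delta' = V (x) B (x) V is 'M[B]_r,
   where x (x)_B y is [x *m y] and v_s (x) b (x) v_t is b E_st. The flip tau is
   transposition and, B being commutative, the right action of B on Delta is
   [*:%R]. *)
Section CellBimodule.
Variables (k : fieldType) (A : algType k) (B : comAlgType k) (r : nat).
Implicit Types (act : A -> 'cV[B]_r -> 'cV[B]_r) (M : 'M[B]_r).

(* With b = 0, the third clause says that k acts in the same way through A and
   through B. *)
Definition is_bimodule act : Prop :=
  [/\ forall x, act 1 x = x,
      forall a b x, act (a * b) x = act a (act b x),
      forall c a b x, act (c *: a + b) x = c%:A *: act a x + act b x &
      forall a (b : B) x y, act a (b *: x + y) = b *: act a x + act a y].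

Definition dual_act (i : A -> A) act (y : 'rV[B]_r) (a : A) : 'rV[B]_r :=
  (act (i a) y^T)^T.

Definition lact act (a : A) M : 'M[B]_r := \matrix_(s, t) act a (col t M) s 0.

Definition ract (i : A -> A) act M (a : A) : 'M[B]_r :=
  \matrix_(s, t) dual_act i act (row s M) a 0 t.

Definition theta (sigma : B -> B) M : 'M[B]_r := (map_mx sigma M)^T.

Lemma act0 act a : is_bimodule act -> act a 0 = 0.
Proof.
by case=> _ _ _ /(_ a 1 0 0); rewrite scaler0 addr0 scale1r => /eqP;
  rewrite -subr_eq0 opprD addrA subrr sub0r oppr_eq0 => /eqP.
Qed.

Lemma lactE act a (x : 'cV[B]_r) (y : 'rV[B]_r) : is_bimodule act ->
  lact act a (x *m y) = act a x *m y.
Proof.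
move=> bim; have [_ _ _ actD] := bim.
apply/matrixP=> s t; rewrite !mxE big_ord1.
have -> : col t (x *m y) = y 0 t *: x + 0.
  by apply/matrixP=> u v; rewrite !mxE big_ord1 addr0 (ord1 v) mulrC.
by rewrite actD (act0 _ bim) addr0 mxE mulrC.
Qed.

Lemma ractE i act a (x : 'cV[B]_r) (y : 'rV[B]_r) : is_bimodule act ->
  ract i act (x *m y) a = x *m dual_act i act y a.
Proof.
move=> bim; have [_ _ _ actD] := bim.
apply/matrixP=> s t; rewrite !mxE big_ord1.
have -> : (row s (x *m y))^T = x s 0 *: y^T + 0.
  by apply/matrixP=> u v; rewrite !mxE big_ord1 addr0 (ord1 v).
by rewrite actD (act0 _ bim) addr0 !mxE.
Qed.

Lemma thetaE (sigma : B -> B) s t (b1 b2 : B) : k_involution sigma ->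
  theta sigma ((b1 *: delta_mx s 0 : 'cV_r) *m (b2 *: delta_mx 0 t : 'rV_r)) =
  (sigma b2 *: delta_mx t 0 : 'cV_r) *m (sigma b1 *: delta_mx 0 s : 'rV_r).
Proof.
case=> slin sM sK.
have s0 : sigma 0 = 0.
  by have := slin (-1) 0 0; rewrite scaleN1r oppr0 addr0 scaleN1r addNr.
have s1 : sigma 1 = 1 by have := sM (sigma 1) 1; rewrite mulr1 sK mulr1.
apply/matrixP=> u v; rewrite !mxE !big_ord1 !mxE !sM !eqxx !andbT.
by case: (u == t); case: (v == s);
  rewrite ?(mulr1, mulr0, mul1r, mul0r, s0, s1).
Qed.

End CellBimodule.

Record affine_cell_ideal (k : fieldType) (A : algType k) (i : A -> A)
    (J : set A) := AffineCellIdeal {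
  cell_ideal : is_ideal J;
  cell_inv : i @` J = J;
  cell_alg : comAlgType k;
  cell_affine : affine_algebra cell_alg;
  cell_sigma : cell_alg -> cell_alg;
  cell_sigmaP : k_involution cell_sigma;
  cell_rank : nat;
  cell_rank_gt0 : (0 < cell_rank)%N;
  cell_act : A -> 'cV[cell_alg]_cell_rank -> 'cV[cell_alg]_cell_rank;
  cell_actP : is_bimodule cell_act;
  (* The isomorphism from J; its values outside J are irrelevant. *)
  cell_alpha : A -> 'M[cell_alg]_cell_rank;
  cell_alpha_bij : set_bij J setT cell_alpha;
  cell_alphaD : {in J &, {morph cell_alpha : x y / x + y}};
  cell_alphaMl : forall a x, J x ->
    cell_alpha (a * x) = lact cell_act a (cell_alpha x);
  cell_alphaMr : forall a x, J x ->
    cell_alpha (x * a) = ract i cell_act (cell_alpha x) a;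
  cell_alpha_inv : forall x, J x ->
    cell_alpha (i x) = theta cell_sigma (cell_alpha x)
}.

(* psi is the matrix with J ~ (M_r(B), psi) through alpha. *)
Definition cell_matrix (k : fieldType) (A : algType k) (i : A -> A)
    (J : set A) (D : affine_cell_ideal i J)
    (psi : 'M[cell_alg D]_(cell_rank D)) : Prop :=
  forall x y, J x -> J y ->
    cell_alpha D (x * y) = cell_alpha D x *m psi *m cell_alpha D y.

Arguments cell_matrix {k A i J} D psi.

(* [partial_sum J' j] is the sum of the J'_l with l < j, so that it is J_(j-1)
   in the cell chain. *)
Definition partial_sum (k : fieldType) (A : algType k) (n : nat)
    (J' : 'I_n.+1 -> submodClosed A) (j : nat) : set A :=
  [set a | exists x : 'I_n.+1 -> A, (forall l, x l \in J' l) /\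
    a = \sum_(l < n.+1 | (l < j)%N) x l].

(* [chain_prev C j] is J_(j-1), for 0 <= j <= n. Asking that it be proper is no
   restriction, as every layer J_j / J_(j-1) is nonzero; the last term J_n is
   A itself. *)
Record cell_chain (k : fieldType) (A : algType k) (i : A -> A) (n : nat) :=
  CellChain {
  chain_part : 'I_n.+1 -> submodClosed A;
  chain_decomp : forall a : A, exists! x : {ffun 'I_n.+1 -> A},
    (forall l, x l \in chain_part l) /\ a = \sum_(l < n.+1) x l;
  chain_part_inv : forall l, i @` [set` chain_part l] = [set` chain_part l];
  chain_prev : 'I_n.+1 -> properIdeal A;
  chain_prevE : forall j,
    in_ideal (chain_prev j) = partial_sum chain_part j;
  chain_cell : forall j,
    affine_cell_ideal (quotAlg_inv (I := chain_prev j) i)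
      [set quotAlg_pi (chain_prev j) x | x in partial_sum chain_part j.+1]
}.

Section Chain.
Variables (k : fieldType) (A : algType k) (i : A -> A) (n : nat).
Variables (C : cell_chain i n) (j : 'I_n.+1).

(* A / J_(j-1) and its ideal J_j / J_(j-1). *)
Definition chain_quot : algType k := quotAlg (chain_prev C j).
Definition chain_layer : set chain_quot :=
  [set quotAlg_pi (chain_prev C j) x | x in partial_sum (chain_part C) j.+1].

Definition chain_B : comAlgType k := cell_alg (chain_cell C j).
Definition chain_rank : nat := cell_rank (chain_cell C j).

End Chain.

Arguments chain_quot {k A i n} C j.
Arguments chain_layer {k A i n} C j _.

(* For Noetherian B with finite Kdim, this is also the module-theoretic
   (deviation) Krull dimension. *)
Definition Kdim (R : realType) (B : comNzRingType) : \bar R :=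
  ereal_sup [set (d%:R)%:E | d in [set d : nat |
    exists P : 'I_d.+1 -> prime_idealr B, forall s t : 'I_d.+1, (s < t)%N ->
      {subset P s <= P t} /\ ~ {subset P t <= P s}]].

Section GelfandKirillov.
Variable k : fieldType.

Definition lspan (V : lmodType k) (S : set V) : set V :=
  [set v | exists (d : nat) (x : 'I_d -> V) (c : 'I_d -> k),
    (forall s, S (x s)) /\ v = \sum_(s < d) c s *: x s].

Definition lin_indep (V : lmodType k) (d : nat) (x : 'I_d -> V) : Prop :=
  forall c : 'I_d -> k, \sum_(s < d) c s *: x s = 0 -> forall s, c s = 0.

Definition has_dim (V : lmodType k) (W : set V) (d : nat) : Prop :=
  exists x : 'I_d -> V, lin_indep x /\ W = lspan (range x).

(* The dimension of W if W is a finite-dimensional subspace, and 0 if not. *)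
Definition dim (V : lmodType k) (W : set V) : nat := xget 0%N (has_dim W).

(* The sum of the powers V^0 = k, V^1, ..., V^n of V. *)
Definition power_sum (A : algType k) (V : set A) (n : nat) : set A :=
  lspan [set \prod_(y <- s) y | s in [set s : seq A |
    (size s <= n)%N /\ forall y, y \in s -> V y]].

Definition GKdim (R : realType) (A : algType k) : \bar R :=
  ereal_sup [set limn_esup
      (fun n => (ln (dim (power_sum V n))%:R / ln n%:R)%:E : \bar R)
    | V in [set V : set A | exists d, has_dim V d]].

End GelfandKirillov.

(* Main.v *)
Require Import Defs.
From HB Require Import structures.
From mathcomp Require Import all_boot all_order all_algebra ring_quotient.
From mathcomp Require Import all_classical all_reals all_analysis.

Set Implicit Arguments.
Unset Strict Implicit.
Unset Printing Implicit Defensive.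

Import Order.TTheory GRing.Theory Num.Theory numFieldNormedType.Exports.
Local Open Scope classical_set_scope.
Local Open Scope ring_scope.

(** For each layer [j] the algebra [A] acts on the cell bimodule of
    J_j / J_(j-1), which gives a representation [chain_rep C j] by square
    matrices over B_j. The theorem compares [A] with the B_j through these
    representations.

    Upper bound. The kernel of the representation on a layer is the preimage of
    the left annihilator of that layer, and the involution turns it into the
    right annihilator ([cell_rep_faithful]). For the layer [m] it is therefore
    J_(m-1). For any layer, the representation is injective on the layer itself
    because the determinant of psi_j is regular ([cell_rep_inj_layer]).
    Descending the chain, the representations with [j <= m] are jointly
    injective ([chain_rep_jointly_inj]), so that [A] embeds into the product of
    the matrix algebras over B_0, ..., B_m. The matrix size only contributes a
    constant factor to the growth, and it remains to bound the growth of an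
    affine commutative algebra by its Krull dimension ([GKdim_le_Kdim]).

    This bound comes from Noether normalization ([noether_normalization]): B is
    finite over a polynomial ring in [d] variables. Counting monomials shows
    that B grows at most like [n ^ d] ([finite_over_growth]), and lifting the
    chain of primes generated by the first variables to B shows that B has Krull
    dimension at least [d] ([going_up], [finite_over_le_Kdim]). The lifting uses
    a determinant trick and the existence of prime ideals avoiding a
    multiplicative set.

    Lower bound. Given a chain of [d + 1] primes of B_l, elements chosen in the
    successive differences are algebraically independent ([chain_ev_notin]), so
    that B_l grows at least like [n ^ d]. If the layer [l] is a finitely generated
    left module, then the whole matrix algebra over B_l is generated by finitely
    many matrices over the image of [A]. Multiplication by elements of B_l on
    these generators is then expressed by finitely many elements of [A], whose
    span must grow at least as fast as B_l, up to a constant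
    ([Kdim_le_GKdim]). *)

(** * Spans and dimension *)

Section Spans.
Variable k : fieldType.

Definition is_subspace (V : lmodType k) (W : set V) : Prop :=
  W 0 /\ forall c x y, W x -> W y -> W (c *: x + y).

Lemma subspaceD (V : lmodType k) (W : set V) x y :
  is_subspace W -> W x -> W y -> W (x + y).
Proof. by move=> [_ WD] Wx Wy; rewrite -[x]scale1r; apply: WD. Qed.

Lemma subspaceZ (V : lmodType k) (W : set V) c x :
  is_subspace W -> W x -> W (c *: x).
Proof. by move=> [W0 WD] Wx; rewrite -[_ *: _]addr0; apply: WD. Qed.

Lemma subspace_sum (V : lmodType k) (W : set V) (I : Type) (r : seq I)
    (P : pred I) (F : I -> V) :
  is_subspace W -> (forall i, P i -> W (F i)) -> W (\sum_(i <- r | P i) F i).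
Proof.
by move=> sW WF; have [W0 _] := sW; apply: big_ind => // x y; apply: subspaceD.
Qed.

Lemma lspan_min (V : lmodType k) (W S : set V) :
  is_subspace W -> S `<=` W -> lspan S `<=` W.
Proof.
move=> sW SW _ [d [x [c [Sx ->]]]].
by apply: subspace_sum => // s _; apply: subspaceZ => //; apply: SW.
Qed.

Lemma sub_lspan (V : lmodType k) (S : set V) : S `<=` lspan S.
Proof.
move=> v Sv; exists 1%N, (fun=> v), (fun=> 1); split => //.
by rewrite big_ord1 scale1r.
Qed.

Lemma is_subspace_lspan (V : lmodType k) (S : set V) : is_subspace (lspan S).
Proof.
split=> [|c _ _ [d [x [a [Sx ->]]]] [e [y [b [Sy ->]]]]].
  by exists 0%N, (fun=> 0), (fun=> 0); split=> [[]|]//; rewrite big_ord0.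
exists (d + e)%N,
  (fun s => match fintype.split s with inl s => x s | inr s => y s end),
  (fun s => match fintype.split s with inl s => c * a s | inr s => b s end).
split=> [s|]; first by case: (fintype.split s).
rewrite big_split_ord scaler_sumr /=; congr (_ + _); apply: eq_bigr => s _.
  by rewrite (unsplitK (inl _)) scalerA.
by rewrite (unsplitK (inr _)).
Qed.

Lemma lspan_rangeP (V : lmodType k) (T : finType) (y : T -> V) v :
  lspan (range y) v <-> exists c : T -> k, v = \sum_t c t *: y t.
Proof.
split=> [|[c ->]]; last first.
  apply: subspace_sum => [|t _]; first exact: is_subspace_lspan.
  by apply: subspaceZ; [exact: is_subspace_lspan|apply: sub_lspan; exists t].
pose W := [set v | exists c : T -> k, v = \sum_t c t *: y t].
apply: (@lspan_min V W) => [|_ [t _ <-]].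
  split=> [|c _ _ [a ->] [b ->]].
    by exists (fun=> 0); rewrite big1// => t _; rewrite scale0r.
  exists (fun t => c * a t + b t); rewrite scaler_sumr -big_split /=.
  by apply: eq_bigr => t _; rewrite scalerDl scalerA.
exists (fun t' => (t' == t)%:R); rewrite (bigD1 t)//= eqxx scale1r big1 ?addr0//.
by move=> t' /negbTE->; rewrite scale0r.
Qed.

Lemma linear_at0 (V U : lmodType k) (f : V -> U) : linear f -> f 0 = 0.
Proof.
by move=> lf; have := lf (-1) 0 0; rewrite scaleN1r oppr0 addr0 scaleN1r addNr.
Qed.

Lemma linear_comb (V U : lmodType k) (f : V -> U) (I : finType) (c : I -> k)
    (x : I -> V) : linear f ->
  f (\sum_i c i *: x i) = \sum_i c i *: f (x i).
Proof.
move=> lf; have f0 := linear_at0 lf.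
apply: (big_ind2 (fun v u => f v = u)) => // [v u w t <- <-|i _].
  by rewrite -[v]scale1r lf !scale1r.
by rewrite -[_ *: x i]addr0 lf f0 addr0.
Qed.

Definition free_fam (V : lmodType k) (S : finType) (x : S -> V) : Prop :=
  forall c : S -> k, \sum_s c s *: x s = 0 -> forall s, c s = 0.

(** Every dimension estimate rests on this form of the exchange lemma. Instead
    of one injective map into a finite-dimensional space it takes jointly
    injective maps [f j], because the targets met below are entries of matrices
    over several different algebras. The coordinates of all the [f j (x s)]
    form one matrix with [#|S|] rows, and a vector in its left kernel is a
    linear relation between the [x s]. *)
Lemma card_free_le (V : lmodType k) (S J : finType) (x : S -> V)
    (U : J -> lmodType k) (f : forall j, V -> U j) (T : J -> finType)
    (y : forall j, T j -> U j) :
    free_fam x -> (forall j, linear (f j)) ->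
    (forall v, (forall j, f j v = 0) -> v = 0) ->
    (forall s j, lspan (range (y j)) (f j (x s))) ->
  (#|S| <= \sum_j #|T j|)%N.
Proof.
have -> : (\sum_j #|T j|)%N = #|{: {j : J & T j}}|.
  by rewrite card_tagged sumnE big_map big_enum.
move=> xfree flin finj fxy.
have aP s j : exists c : T j -> k, f j (x s) = \sum_t c t *: y j t.
  exact/lspan_rangeP.
pose a s j := sval (cid (aP s j)).
have aE s j : f j (x s) = \sum_t a s j t *: y j t := svalP (cid (aP s j)).
rewrite leqNgt; apply/negP => ltTS.
pose M : 'M[k]_(#|S|, #|{: {j : J & T j}}|) :=
  \matrix_(s, q) a (enum_val s) (tag (enum_val q)) (tagged (enum_val q)).
have /rowV0Pn[v vM v0] : kermx M != 0.
  rewrite -mxrank_eq0 mxrank_ker subn_eq0 -ltnNge.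
  exact: leq_ltn_trans (rank_leq_col _) ltTS.
have {}vM : v *m M = 0 by apply/sub_kermxP.
case/negP: v0; apply/eqP/matrixP => i s; rewrite (ord1 i) !mxE.
rewrite -(enum_valK s); move: (enum_val s) => {}s.
apply: (xfree (fun s => v 0 (enum_rank s))); apply: finj => j.
rewrite linear_comb//; under eq_bigr => s' _.
  rewrite aE scaler_sumr; over.
rewrite exchange_big big1//= => t _.
under eq_bigr do rewrite scalerA.
rewrite -scaler_suml; apply/eqP; rewrite scaler_eq0; apply/orP; left.
move/matrixP/(_ 0 (enum_rank (Tagged T t))): vM; rewrite !mxE => vM.
rewrite (reindex_onto enum_val enum_rank)/= => [|s' _]; last exact: enum_rankK.
rewrite -[X in _ == X]vM; apply/eqP; apply: eq_big => s'; rewrite enum_valK ?eqxx//.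
by move=> _; rewrite !mxE enum_rankK.
Qed.

Lemma card_free_span (V : lmodType k) (S T : finType) (x : S -> V) (y : T -> V) :
  free_fam x -> (forall s, lspan (range y) (x s)) -> (#|S| <= #|T|)%N.
Proof.
move=> xfree xy.
have := @card_free_le V S unit x (fun=> V) (fun _ v => v) (fun=> T) (fun=> y).
by rewrite sum_nat_const card_unit mul1n; apply=> // v /(_ tt).
Qed.

Lemma has_dim_uniq (V : lmodType k) (W : set V) d e :
  has_dim W d -> has_dim W e -> d = e.
Proof.
have le d1 d2 (x : 'I_d1 -> V) (y : 'I_d2 -> V) : lin_indep x ->
    lspan (range x) = lspan (range y) -> (d1 <= d2)%N.
  move=> xfree xy; have := @card_free_span V _ _ x y; rewrite !card_ord; apply=> // s.
  by rewrite -xy; apply: sub_lspan; exists s.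
move=> [x [xfree ->]] [y [yfree xy]].
by apply/eqP; rewrite eqn_leq (le _ _ x y)// (le _ _ y x).
Qed.

Lemma dimE (V : lmodType k) (W : set V) d : has_dim W d -> Defs.dim W = d.
Proof.
move=> Wd; apply: (@has_dim_uniq V W) => //.
exact: (xgetPex 0%N (ex_intro (has_dim W) d Wd)).
Qed.

(** A free family of maximal size in [W] is a basis of [W]. *)
Lemma has_dim_fin (V : lmodType k) (W : set V) (T : finType) (y : T -> V) :
  is_subspace W -> W `<=` lspan (range y) -> exists d, has_dim W d.
Proof.
move=> sW Wy.
pose Q d := `[< exists2 x : 'I_d -> V, lin_indep x & forall s, W (x s) >].
have Q0 : exists d, Q d.
  exists 0%N; apply/asboolP; exists (fun=> 0) => [c _ []//|[]//].
have Qle d : Q d -> (d <= #|T|)%N.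
  move=> /asboolP[x xfree Wx]; have := @card_free_span V _ _ x y.
  by rewrite card_ord; apply=> // s; apply/Wy.
case: (ex_maxnP Q0 Qle) => d /asboolP[x xfree Wx] dmax.
exists d, x; split => //; apply/seteqP; split=> [v Wv|]; last first.
  by apply: (@lspan_min V W) => // _ [s _ <-].
apply: contrapT => xv.
suff /dmax : Q d.+1 by rewrite ltnn.
apply/asboolP; exists (fun s : 'I_d.+1 => oapp x v (unlift ord0 s)); last first.
  by move=> s; case: (unliftP ord0 s) => [s0|] _ /=.
move=> c; rewrite big_ord_recl unlift_none /= => c0.
have {}c0 : c ord0 *: v + \sum_(s < d) c (lift ord0 s) *: x s = 0.
  by rewrite -[RHS]c0; congr (_ + _); apply: eq_bigr => s _; rewrite liftK.
have cv0 : c ord0 = 0.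
  apply: contrapT => /eqP cv0; case: xv; apply/lspan_rangeP.
  exists (fun s => - (c ord0)^-1 * c (lift ord0 s)).
  under eq_bigr do rewrite -scalerA.
  rewrite -scaler_sumr; move/eqP: c0; rewrite addrC addr_eq0 => /eqP ->.
  by rewrite scalerN scaleNr opprK scalerA mulVf// scale1r.
move=> s; case: (unliftP ord0 s) => [s' ->|->//].
apply: (xfree (fun s => c (lift ord0 s))).
by rewrite cv0 scale0r add0r in c0.
Qed.

Lemma has_dim_range (V : lmodType k) (T : finType) (y : T -> V) :
  exists d, has_dim (lspan (range y)) d.
Proof. by apply: (@has_dim_fin V _ T y) => //; apply: is_subspace_lspan. Qed.

End Spans.

(** * Iterated polynomial rings *)

Section IteratedPolynomials.
Variable k : fieldType.

(** Polynomials in [d] variables are built one variable at a time, because this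
    is how every induction below proceeds. *)
Fixpoint iterpoly (d : nat) : idomainType :=
  if d is d'.+1 then {poly iterpoly d'} else k.

Fixpoint ev (B : comAlgType k) (d : nat) (z : nat -> B) {struct d} :
    {rmorphism iterpoly d -> B} :=
  if d is d'.+1 return {rmorphism iterpoly d -> B} then
    horner_eval (z 0%N) \o map_poly (ev d' (fun i => z i.+1))
  else in_alg B.

Fixpoint iterC (d : nat) : {rmorphism k -> iterpoly d} :=
  if d is d'.+1 return {rmorphism k -> iterpoly d} then polyC \o iterC d'
  else idfun.

Lemma evS (B : comAlgType k) d (z : nat -> B) (f : iterpoly d.+1) :
  ev d.+1 z f = (map_poly (ev d (fun i => z i.+1)) f).[z 0%N].
Proof. by []. Qed.

Lemma ev_iterC (B : comAlgType k) d (z : nat -> B) c : ev d z (iterC d c) = c%:A.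
Proof.
elim: d z => [|d IHd] z //.
by rewrite evS /= map_polyC hornerC; apply: IHd.
Qed.

Lemma evS_sum (B : comAlgType k) d (z : nat -> B) (f : iterpoly d.+1) n :
  (size f <= n)%N ->
  ev d.+1 z f = \sum_(i < n) ev d (fun i => z i.+1) f`_i * z 0%N ^+ i.
Proof.
move=> fn; rewrite evS (horner_coef_wide _ (leq_trans (size_poly _ _) fn)).
by apply: eq_bigr => i _; rewrite coef_map.
Qed.

End IteratedPolynomials.

(** * Noether normalization *)

Section NoetherNormalization.
Variables (k : fieldType) (B : comAlgType k).

(** Renaming the variables as [z'] makes the given relation [f] unit-leading in
    the outermost variable, at the cost of no element of [k[z]]. The field may
    be finite, so that a linear change of variables need not exist. By
    induction the leading coefficient of [f], a polynomial in [z 1, z 2, ...],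
    can be made unit-leading in some [u]; then replace [z 0] by
    [z 0 - u ^+ e]. For large [e] the top term of [f] in [z 0] dominates all
    others as a polynomial in [u]. *)
Lemma unit_lead_coef_change d (f : iterpoly k d.+1) (z : nat -> B) : f != 0 ->
  exists z' : nat -> B,
    (forall g : iterpoly k d.+1, exists q : iterpoly k d.+1,
        ev d.+1 z g = ev d.+1 z' q) /\
    exists q : {poly iterpoly k d},
      lead_coef q \is a GRing.unit /\ ev d.+1 z f = ev d.+1 z' q.
Proof.
elim: d f z => [|d IHd] f z f0.
  exists z; split=> [g|]; first by exists g.
  exists f; split => //; have : lead_coef f != 0 by rewrite lead_coef_eq0.
  by rewrite -(unitfE (lead_coef f : k)).
have [z1 [/choice[r rE] [qt [qt_unit qtE]]]] :
    exists z' : nat -> B,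
    (forall g : iterpoly k d.+1, exists q : iterpoly k d.+1,
        ev d.+1 (fun i => z i.+1) g = ev d.+1 z' q) /\
    exists q : {poly iterpoly k d}, lead_coef q \is a GRing.unit /\
      ev d.+1 (fun i => z i.+1) (lead_coef f) = ev d.+1 z' q.
  by apply: IHd; rewrite lead_coef_eq0.
pose e := (\max_(i < size f) size (r (f`_i)%R : {poly _})).+1.
pose z2 i := if i is i'.+1 then
    if i' is i''.+1 then z1 i''.+1 else z 0%N - z1 0%N ^+ e else z1 0%N.
pose lift (q : iterpoly k d.+1) : {poly iterpoly k d.+1} :=
  map_poly polyC (q : {poly iterpoly k d}).
pose Y : {poly iterpoly k d.+1} := 'X^e + ('X : {poly iterpoly k d})%:P.
have evl q : ev d.+2 z2 (lift q) = ev d.+1 z1 q.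
  rewrite !evS /lift -map_poly_comp; congr (_.[_]); apply: eq_map_poly => c /=.
  by rewrite map_polyC /= /horner_eval hornerC.
have evY : ev d.+2 z2 Y = z 0%N.
  rewrite evS rmorphD/= map_polyXn map_polyC /= /horner_eval map_polyX hornerX.
  by rewrite hornerD hornerXn hornerC /z2 addrC subrK.
have sizeY : size Y = e.+1.
  by rewrite size_polyDl size_polyXn// size_polyC polyX_eq0.
have monY : Y \is monic.
  rewrite monicE lead_coefDl ?lead_coefXn//.
  by rewrite size_polyXn// size_polyC polyX_eq0.
have repE (g : iterpoly k d.+2) (r' : nat -> iterpoly k d.+1) :
    (forall i, ev d.+1 (fun i => z i.+1) g`_i = ev d.+1 z1 (r' i)) ->
    ev d.+2 z g = ev d.+2 z2 (\sum_(i < size g) lift (r' i) * Y ^+ i).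
  move=> r'E; rewrite (@evS_sum _ _ d.+1 z g (size g))// rmorph_sum.
  by apply: eq_bigr => i _; rewrite r'E -evl -evY -rmorphXn -rmorphM.
exists z2; split=> [g|].
  by exists (\sum_(i < size g) lift (r g`_i) * Y ^+ i); apply: (repE g (fun i => r g`_i)).
pose n := (size f).-1.
have sizef : size f = n.+1 by rewrite prednK// lt0n size_poly_eq0.
pose r' i := if i == n then qt else r f`_i.
exists (\sum_(i < size f) lift (r' i) * Y ^+ i); split; last first.
  by apply: (repE f r') => i; rewrite /r'; case: eqP => [->|].
have qt0 : qt != 0.
  by apply: contraTneq qt_unit => ->; rewrite lead_coef0 unitr0.
have lift0 : lift qt != 0.
  rewrite -size_poly_eq0 size_map_inj_poly ?size_poly_eq0//; exact: polyC_inj.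
rewrite sizef big_ord_recr lead_coefDr /=.
  rewrite lead_coef_Mmonic ?monic_exp// /r' eqxx lead_coef_map_inj//; last first.
    exact: polyC_inj.
  exact: (rmorph_unit (polyC : {rmorphism iterpoly k d -> _})).
rewrite /r' eqxx size_Mmonic ?monic_exp//.
have sizeYn i : size (Y ^+ i) = (e * i).+1.
  rewrite -[LHS]prednK; first by rewrite size_exp sizeY.
  by rewrite lt0n size_poly_eq0 monic_neq0// monic_exp.
rewrite sizeYn addnS /= -(prednK (_ : (0 < size (lift qt))%N)); last first.
  by rewrite lt0n size_poly_eq0.
rewrite ltnS; apply: leq_trans (leq_addl _ _).
apply: leq_trans (size_sum _ _ _) _; apply/bigmax_leqP => i _.
apply: leq_trans (size_polyMleq _ _) _; rewrite sizeYn addnS /=.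
have ine : (i == n :> nat) = false by rewrite ltn_eqF.
rewrite ine; apply: (@leq_trans (e * i.+1)); last by rewrite leq_mul2l ltn_ord orbT.
rewrite mulnS leq_add2r size_map_inj_poly//; last exact: polyC_inj.
have iltf : (i < size f)%N by rewrite sizef ltnS ltnW.
apply: leqW; exact: (@leq_bigmax _ (fun i : 'I_(size f) =>
  size (r (f`_i)%R : {poly _})) (Ordinal iltf)).
Qed.

Definition finite_over d (z : nat -> B) : Prop :=
  exists (T : finType) (g : T -> B), forall b, exists c : T -> iterpoly k d,
    b = \sum_t ev d z (c t) * g t.

(** An algebraic relation between the [z i] becomes, after the change of
    variables, an integral equation of [z' 0] over the others. *)
Lemma finite_over_drop d (z : nat -> B) (f : iterpoly k d.+1) :
  f != 0 -> ev d.+1 z f = 0 -> finite_over d.+1 z ->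
  exists w : nat -> B, finite_over d w.
Proof.
move=> f0 zf [T [g gP]].
have [z' [/choice[r rE] [q [q_unit qE]]]] := unit_lead_coef_change z f0.
exists (fun i => z' i.+1), (T * 'I_(size q))%type.
exists (fun ti : T * 'I_(size q) => z' 0%N ^+ ti.2 * g ti.1) => b; have [c ->] := gP b.
exists (fun ti : T * 'I_(size q) => ((r (c ti.1) : {poly _}) %% q)`_(ti.2)).
rewrite -(pair_bigA _ (fun t (i : 'I_(size q)) => ev d (fun i => z' i.+1)
  ((r (c t) : {poly _}) %% q)`_i * (z' 0%N ^+ i * g t))).
apply: eq_bigr => t _; rewrite rE.
rewrite {1}(Pdiv.IdomainUnit.divp_eq q_unit (r (c t))) rmorphD rmorphM.
rewrite -qE zf mulr0 add0r (@evS_sum _ _ d z' _ (size q)); last first.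
  by rewrite ltnW// Pdiv.Idomain.ltn_modp -lead_coef_eq0;
    apply: contraTneq q_unit => ->; rewrite unitr0.
by rewrite mulr_suml; apply: eq_bigr => i _; rewrite mulrA.
Qed.

Lemma ev_var d (z : nat -> B) i : (i < d)%N -> exists f, ev d z f = z i.
Proof.
elim: d z i => // d IHd z [_|i /(IHd (fun i => z i.+1))[f fE]].
  by exists 'X; rewrite evS map_polyX hornerX.
by exists (f%:P); rewrite evS map_polyC hornerC.
Qed.

Lemma affine_finite_over : affine_algebra B ->
  exists d (z : nat -> B), finite_over d z.
Proof.
move=> [s sP]; exists (size s), (nth 0 s), unit, (fun=> 1) => b.
pose E := ev (size s) (nth 0 s).
pose S : pred B := fun b => `[< exists f, b = E f >].
have SP : subalg_closed S.
  split=> [|a _ _ /asboolP[f ->] /asboolP[h ->]|_ _ /asboolP[f ->] /asboolP[h ->]].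
  - by apply/asboolP; exists 1; rewrite rmorph1.
  - apply/asboolP; exists (iterC k (size s) a * f + h).
    by rewrite rmorphD rmorphM {2}/E ev_iterC mulr_algl.
  - by apply/asboolP; exists (f * h); rewrite rmorphM.
pose SC : subalgClosed B := HB.pack S
  (GRing.isSubalgClosed.Build k B S (GRing.subalg_closed_semi SP)).
have /asboolP[f ->] : b \in S.
  apply: (sP SC) => x /(nthP 0)[i si <-]; apply/asboolP.
  by have [f <-] := ev_var (nth 0 s) si; exists f.
by exists (fun=> f); rewrite big_const card_unit /= addr0 mulr1.
Qed.

Lemma noether_normalization : affine_algebra B ->
  exists d (z : nat -> B), injective (ev d z) /\ finite_over d z.
Proof.
move=> /affine_finite_over[d [z]]; elim: d z => [|d IHd] z zfin.
  by exists 0%N, z; split => //; apply: fmorph_inj.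
have [[f f0 zf]|zinj] := pselect (exists2 f, f != 0 & ev d.+1 z f = 0).
  by have [w /IHd] := finite_over_drop f0 zf zfin.
exists d.+1, z; split=> // f h /eqP; rewrite -subr_eq0 -rmorphB => /eqP zfh.
by apply/eqP; rewrite -subr_eq0; apply: contrapT => /negP fh; case: zinj;
  exists (f - h).
Qed.

End NoetherNormalization.

(** * Chains of prime ideals in finite extensions of polynomial rings *)

Section PrimeIdeals.
Variable B : comNzRingType.

(** An ideal maximal among those containing [I] and avoiding [S] is prime. *)
Lemma prime_avoiding (I S : set B) :
    is_ideal I -> S 1 -> (forall x y, S x -> S y -> S (x * y)) ->
    (forall x, I x -> ~ S x) ->
  exists P : prime_idealr B,
    (forall x, I x -> x \in P) /\ (forall x, x \in P -> ~ S x).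
Proof.
move=> idI S1 SM IS.
pose good J := [/\ is_ideal J, I `<=` J & forall x, J x -> ~ S x].
(* The empty set is admitted because Zorn's lemma also asks for the union of
   the empty chain. *)
have [|A [PA Amax]] := @Zorn_bigcup B (fun J => J = set0 \/ good J).
  move=> F FP Ftot.
  have [Fne|F0] := pselect (exists2 J, F J & J !=set0); last first.
    left; apply/seteqP; split=> // x [J FJ Jx]; case: F0; exists J => //.
    by exists x.
  right; have goodF J x : F J -> J x -> good J.
    by move=> FJ Jx; case: (FP J FJ) => // J0; move: Jx; rewrite J0.
  have [J FJ [x Jx]] := Fne; have [[J0 _ _ _] IJ _] := goodF _ _ FJ Jx.
  split=> [|y Iy|y [K FK Ky]].
  - split=> [|y z [K FK Ky] [L FL Lz]|a y [K FK Ky]|a y [K FK Ky]].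
    + by exists J.
    + have [[_ KB _ _] _ _] := goodF _ _ FK Ky.
      have [[_ LB _ _] _ _] := goodF _ _ FL Lz.
      case: (Ftot _ _ FK FL) => sub.
        by exists L => //; apply: LB => //; apply: sub.
      by exists K => //; apply: KB => //; apply: sub.
    + by have [[_ _ KM _] _ _] := goodF _ _ FK Ky; exists K => //; apply: KM.
    + by have [[_ _ _ KM] _ _] := goodF _ _ FK Ky; exists K => //; apply: KM.
  - by exists J => //; apply: IJ.
  - by have [_ _] := goodF _ _ FK Ky; apply.
have [idA IA AS] : good A.
  case: PA => // A0; case: (Amax I); last by right; split.
  rewrite A0; split=> // /(_ 0); have [I0 _ _ _] := idI.
  by move=> /(_ I0).
have [A0 AB AMl AMr] := idA.
have AD x y : A x -> A y -> A (x + y).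
  by move=> Ax Ay; rewrite -[y]opprK -[- y]sub0r; do 2!apply: (AB) => //.
have meetS u : ~ A u -> exists a b, A a /\ S (a + b * u).
  move=> Au; apply: contrapT => noS.
  pose J := [set x | exists a b, A a /\ x = a + b * u].
  have AJ : A `<=` J by move=> x Ax; exists x, 0; rewrite mul0r addr0.
  apply: (Amax J).
    split => // JA; apply: Au; apply: JA; exists 0, 1.
    by rewrite mul1r add0r.
  have JM c x : J x -> J (c * x).
    move=> [a [b [Aa ->]]]; exists (c * a), (c * b); rewrite mulrDr mulrA.
    by split=> //; apply: AMl.
  right; split=> [||x [a [b [Aa ->]]] Sx]; last by case: noS; exists a, b.
    split=> [|_ _ [a [b [Aa ->]]] [a' [b' [Aa' ->]]]||c x Jx].
    + exact: AJ.
    + exists (a - a'), (b - b'); split; first exact: AB.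
      by rewrite mulrBl opprD addrACA.
    + exact: JM.
    + by rewrite mulrC; apply: JM.
  exact: subset_trans AJ.
pose p : pred B := fun x => `[< A x >].
have p_ideal : idealr_closed p.
  split; first exact/asboolP.
    by apply/negP => /asboolP A1; apply: AS A1 S1.
  move=> a u v /asboolP Au /asboolP Av; apply/asboolP.
  by apply: AD => //; apply: AMl.
have p_prime : prime_idealr_closed p.
  move=> u v /asboolP Auv; apply: contrapT => /negP; rewrite negb_or.
  move=> /andP[/asboolP/meetS[a [b [Aa Su]]] /asboolP/meetS[a' [b' [Aa' Sv]]]].
  apply: AS (SM _ _ Su Sv); rewrite mulrDl; apply: (AD); first exact: AMr.
  rewrite mulrDr; apply: (AD); first exact: (AMl).
  by rewrite mulrACA; apply: AMl.
pose P : prime_idealr B := HB.pack p (isIdealr.Build B p p_ideal)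
  (isPrimeIdealrClosed.Build B p p_prime).
exists P.
by split=> x; [move=> /IA Ax; apply/asboolP|move=> /asboolP/AS].
Qed.

End PrimeIdeals.

Section GoingUp.
Variables (C B : comNzRingType) (h : {rmorphism C -> B}).
Variables (n : nat) (g : 'I_n -> B).
Hypothesis gP : forall b, exists c : 'I_n -> C, b = \sum_t h (c t) * g t.

(** The determinant trick. If [h c] lies in [I + ker(e) B], then multiplication
    by [c] acts on the generators, modulo [I], through a matrix [M] with entries
    in the kernel of [e]. The determinant of [c - M] is carried into [I] by [h],
    and [e] maps it to a power of [e c]. *)
Lemma ker_extended (D : idomainType) (e : {rmorphism C -> D}) (I : set B) c :
    is_ideal I -> (forall c, I (h c) -> e c = 0) ->
    (forall s, exists a : 'I_n -> C, (forall t, e (a t) = 0) /\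
       I (h c * g s - \sum_t h (a t) * g t)) ->
  e c = 0.
Proof.
move=> [I0 IB IMl _] Ie /choice[a aP].
have ID x y : I x -> I y -> I (x + y).
  by move=> Ix Iy; rewrite -[y]opprK -[- y]sub0r; do 2!apply: (IB) => //.
pose N : 'M[C]_n := c%:M - \matrix_(s, t) a s t.
have Ng s : I (\sum_t h (N s t) * g t).
  have [_] := aP s; congr I.
  under [RHS]eq_bigr do rewrite !mxE rmorphB mulrBl.
  rewrite sumrB; congr (_ - _).
  rewrite (bigD1 s)//= eqxx mulr1n big1 ?addr0// => t ts.
  by rewrite eq_sym (negbTE ts) mulr0n rmorph0 mul0r.
have detg u : I (h (\det N) * g u).
  have -> : h (\det N) * g u = \sum_s h ((\adj N) u s) * (\sum_t h (N s t) * g t).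
    under eq_bigr do rewrite mulr_sumr; rewrite exchange_big /=.
    under eq_bigr => t _.
      under eq_bigr do rewrite mulrA -rmorphM; rewrite -mulr_suml -rmorph_sum.
      over.
    have adjN t : \sum_s (\adj N) u s * N s t = ((\det N)%:M : 'M[C]_n) u t.
      by rewrite -mul_adj_mx mxE.
    under eq_bigr do rewrite adjN mxE.
    rewrite (bigD1 u)//= eqxx mulr1n big1 ?addr0// => t tu.
    by rewrite eq_sym (negbTE tu) mulr0n rmorph0 mul0r.
  by apply: (big_ind I) => // s _; apply: IMl.
have /Ie : I (h (\det N)).
  rewrite -[h _]mulr1; have [b ->] := gP 1; rewrite mulr_sumr.
  by apply: (big_ind I) => // s _; rewrite mulrCA; apply: IMl.
rewrite -det_map_mx (_ : map_mx e N = (e c)%:M) ?det_scalar.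
  by move=> /eqP; rewrite expf_eq0 => /andP[_ /eqP].
apply/matrixP => s t; rewrite !mxE rmorphB rmorphMn/=.
by have [-> _] := aP s; rewrite subr0.
Qed.

(** By [ker_extended] the ideal [I + ker(e) B] meets the image of [C] only in
    the image of the kernel of [e], so a prime ideal may contain it and avoid
    the image of everything else. *)
Lemma going_up (D : idomainType) (e : {rmorphism C -> D}) (I : set B) :
    is_ideal I -> (forall c, I (h c) -> e c = 0) ->
  exists P : prime_idealr B,
    (forall x, I x -> x \in P) /\ (forall c, h c \in P <-> e c = 0).
Proof.
move=> idI Ie; have [I0 IB IMl IMr] := idI.
have ID x y : I x -> I y -> I (x + y).
  by move=> Ix Iy; rewrite -[y]opprK -[- y]sub0r; do 2!apply: (IB) => //.
pose J := [set x | exists a : 'I_n -> C,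
  (forall t, e (a t) = 0) /\ I (x - \sum_t h (a t) * g t)].
have JMl b x : J x -> J (b * x).
  move=> [a [ea Ix]].
  have /choice[r rE] t : exists c : 'I_n -> C, b * g t = \sum_s h (c s) * g s.
    exact: gP.
  exists (fun s => \sum_t a t * r t s); split=> [s|].
    by rewrite rmorph_sum big1// => t _; rewrite rmorphM ea mul0r.
  have := IMl b _ Ix; congr I; rewrite mulrBr; congr (_ - _).
  rewrite mulr_sumr; under eq_bigr do rewrite mulrCA rE mulr_sumr.
  rewrite exchange_big; apply: eq_bigr => s _; rewrite rmorph_sum mulr_suml.
  by apply: eq_bigr => t _; rewrite rmorphM mulrA.
have idJ : is_ideal J.
  split=> [|x y [a [ea Ix]] [b [eb Iy]]|//|b x Jx].
  - exists (fun=> 0); split=> [t|]; first exact: rmorph0.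
    by rewrite big1 ?subr0// => t _; rewrite rmorph0 mul0r.
  - exists (fun t => a t - b t); split=> [t|]; first by rewrite rmorphB ea eb subr0.
    have := IB _ _ Ix Iy; congr I.
    under [in RHS]eq_bigr do rewrite rmorphB mulrBl.
    by rewrite sumrB !opprD addrACA.
  - by rewrite mulrC; apply: JMl.
have Je c : J (h c) -> e c = 0.
  move=> Jc; apply: (ker_extended idI Ie) => s.
  by have := JMl (g s) _ Jc; rewrite mulrC.
have [|x y [c ec <-] [c' ec' <-]|x Jx [c ec hc]|P [JP PS]] :=
    @prime_avoiding B J [set h c | c in [set c | e c != 0]] idJ.
- by exists 1; rewrite /= rmorph1 ?oner_neq0.
- by exists (c * c'); rewrite /= rmorphM// mulf_neq0.
- by move: ec; rewrite /= Je ?eqxx// hc.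
exists P; split=> [x Ix|c].
  apply: JP; exists (fun=> 0); split=> [t|]; first exact: rmorph0.
  by rewrite big1 ?subr0// => t _; rewrite rmorph0 mul0r.
split=> [/PS hc|ec].
  by apply: contrapT => /eqP ec; apply: hc; exists c.
apply: JP; have [b bE] := gP 1; exists (fun t => c * b t); split=> [t|].
  by rewrite rmorphM ec mul0r.
rewrite -[h c]mulr1 {1}bE mulr_sumr -sumrB big1// => t _.
by rewrite rmorphM mulrA subrr.
Qed.

(** The kernels of the maps setting more and more variables to zero are prime
    ideals of [C]; [going_up] lifts their chain step by step. *)
Lemma prime_chain_above (k : fieldType) d (e : {rmorphism C -> iterpoly k d})
    (I : set B) :
    (forall f, exists c, e c = f) -> is_ideal I ->
    (forall c, I (h c) -> e c = 0) ->
  exists P : 'I_d.+1 -> prime_idealr B,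
    [/\ forall x, I x -> x \in P ord0, forall c, h c \in P ord0 <-> e c = 0 &
      forall s t : 'I_d.+1, (s < t)%N ->
        {subset P s <= P t} /\ ~ {subset P t <= P s}].
Proof.
elim: d e I => [|d IHd] e I esurj idI Ie; have [P0 [IP0 P0e]] := going_up idI Ie.
  by exists (fun=> P0); split=> // s t; rewrite !ord1.
have [||c P0c|P [P0P PE Plt]] := IHd (horner_eval 0 \o e) [set` P0].
- move=> f; have [c ec] := esurj f%:P; exists c.
  by rewrite /= ec /horner_eval hornerC.
- split=> [|x y|a x|a x] /=; rewrite ?rpred0//.
  + by move=> xP yP; rewrite rpredB.
  + exact: idealMr.
  + by rewrite mulrC; apply: idealMr.
- by rewrite /= (P0e c).1// /horner_eval horner0.
exists (fun s => oapp P P0 (unlift ord0 s)); split=> [||s t].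
- by rewrite unlift_none.
- by rewrite unlift_none.
case: (unliftP ord0 s) => [s' ->|->]; case: (unliftP ord0 t) => [t' ->|->] //=.
  by rewrite /bump !add1n ltnS => /Plt.
move=> _.
have PP x : x \in P ord0 -> x \in P t'.
  case: (posnP t') => [t0|t0]; first by rewrite (_ : t' = ord0)//; apply: val_inj.
  by have [+ _] := Plt ord0 t' t0; apply.
split=> [x /P0P/PP//|sub].
have [c ec] := esurj 'X.
have /P0e : h c \in P0.
  by apply/sub/PP/PE; rewrite /= ec /horner_eval hornerX.
by rewrite ec => /eqP; rewrite polyX_eq0.
Qed.

End GoingUp.

Lemma chain_le_Kdim (R : realType) (B : comNzRingType) d
    (P : 'I_d.+1 -> prime_idealr B) :
  (forall s t : 'I_d.+1, (s < t)%N ->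
     {subset P s <= P t} /\ ~ {subset P t <= P s}) ->
  ((d%:R)%:E <= Kdim R B)%E.
Proof. by move=> Plt; apply: ereal_sup_ubound; exists d => //; exists P. Qed.

Lemma finite_over_le_Kdim (R : realType) (k : fieldType) (B : comAlgType k) d
    (z : nat -> B) :
  injective (ev d z) -> finite_over d z -> ((d%:R)%:E <= Kdim R B)%E.
Proof.
move=> zinj [T [g gP]].
have [|f||c|P [_ _]] := @prime_chain_above _ B (ev d z) #|T|
    (fun t => g (enum_val t)) _ k d idfun [set 0].
- move=> b; have [c ->] := gP b; exists (fun t => c (enum_val t)).
  rewrite (reindex_onto enum_val enum_rank)/= => [|t _]; last exact: enum_rankK.
  by apply: eq_bigl => t; rewrite enum_valK eqxx.
- by exists f.
- split=> //= [_ _ -> ->|a _ ->|a _ ->]; rewrite ?subrr ?mulr0 ?mul0r//.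
- by rewrite /= -(rmorph0 (ev d z)) => /zinj.
exact: chain_le_Kdim.
Qed.

(** * Growth of commutative algebras *)

Section Monomials.
Variable k : fieldType.

Fixpoint monidx (n d : nat) : finType :=
  if d is d'.+1 then ('I_n.+1 * monidx n d')%type else unit.

Fixpoint mon (B : comAlgType k) (n d : nat) (z : nat -> B) {struct d} :
    monidx n d -> B :=
  if d is d'.+1 return monidx n d -> B then
    fun a => z 0%N ^+ a.1 * mon (fun i => z i.+1) a.2
  else fun=> 1.

Lemma card_monidx n d : #|monidx n d| = (n.+1 ^ d)%N.
Proof. by elim: d => [|d IHd] /=; rewrite ?card_unit// card_prod card_ord IHd expnS. Qed.

(** With a bound on every partial degree, and not on the total degree, the
    exponents range over a product of intervals and are counted by induction. *)
Fixpoint bdeg (n d : nat) : iterpoly k d -> Prop :=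
  if d is d'.+1 return iterpoly k d -> Prop then
    fun f : {poly iterpoly k d'} => (size f <= n.+1)%N /\ forall i, bdeg n f`_i
  else fun=> True.

Lemma bdeg0 n d : bdeg n (0 : iterpoly k d).
Proof.
elim: d => //= d IHd; split=> [|i]; first by rewrite size_poly0.
by rewrite coef0.
Qed.

Lemma bdegD n d (f g : iterpoly k d) : bdeg n f -> bdeg n g -> bdeg n (f + g).
Proof.
elim: d f g => //= d IHd f g [sf bf] [sg bg]; split=> [|i].
  by rewrite (leq_trans (size_polyD _ _))// geq_max sf.
by rewrite coefD; apply: IHd.
Qed.

Lemma bdeg_sum n d (I : Type) (r : seq I) (P : pred I) (F : I -> iterpoly k d) :
  (forall i, P i -> bdeg n (F i)) -> bdeg n (\sum_(i <- r | P i) F i).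
Proof.
move=> bF; apply: (big_ind (fun f => bdeg n f)) => //; first exact: bdeg0.
exact: bdegD.
Qed.

Lemma bdegM n m d (f g : iterpoly k d) :
  bdeg n f -> bdeg m g -> bdeg (n + m) (f * g).
Proof.
elim: d f g => //= d IHd f g [sf bf] [sg bg]; split=> [|i].
  apply: leq_trans (size_polyMleq _ _) _; have := leq_add sf sg.
  by rewrite addSn addnS; case: addn.
by rewrite coefM; apply: bdeg_sum => j _; apply: IHd.
Qed.

Lemma bdeg_le n m d (f : iterpoly k d) : (n <= m)%N -> bdeg n f -> bdeg m f.
Proof.
move=> nm; elim: d f => //= d IHd f [sf bf]; split=> [|i].
  exact: leq_trans sf _.
exact: IHd.
Qed.

Lemma bdeg_const n d c : bdeg n (iterC k d c).
Proof.
elim: d => //= d IHd; split=> [|i].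
  exact: leq_trans (size_polyC_leq1 _) _.
by rewrite coefC; case: eqP => // _; apply: bdeg0.
Qed.

Lemma bdeg_ex d (f : iterpoly k d) : exists n, bdeg n f.
Proof.
elim: d f => [|d IHd] f; first by exists 0%N.
pose F : {poly iterpoly k d} := f.
have /choice[m mP] i : exists m, bdeg m F`_i by apply: IHd.
exists (maxn (size F) (\max_(i < size F) m i)); split=> [|i].
  by rewrite leqW// leq_maxl.
have [iF|Fi] := ltnP i (size F); last by rewrite nth_default//; apply: bdeg0.
apply: bdeg_le (mP i); rewrite leq_max; apply/orP; right.
exact: (@leq_bigmax _ (fun i : 'I_(size F) => m i) (Ordinal iF)).
Qed.

Lemma ev_bdeg (B : comAlgType k) n d (z : nat -> B) (f : iterpoly k d) :
  bdeg n f -> lspan (range (mon (n := n) (d := d) z)) (ev d z f).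
Proof.
elim: d z f => [|d IHd] z f.
  move=> _; apply/lspan_rangeP; exists (fun=> f).
  by rewrite (big_pred1 tt) => [|[]].
move=> [sf bf]; rewrite (@evS_sum _ _ d z f n.+1)//.
apply: subspace_sum => [|i _]; first exact: is_subspace_lspan.
have /lspan_rangeP[c ->] := IHd (fun i => z i.+1) _ (bf i).
rewrite mulr_suml; apply: subspace_sum => [|a _]; first exact: is_subspace_lspan.
rewrite -scalerAl mulrC; apply: subspaceZ; first exact: is_subspace_lspan.
by apply: sub_lspan; exists (i, a).
Qed.

Fixpoint monpoly (n d : nat) : (monidx n d -> k) -> iterpoly k d :=
  if d is d'.+1 return (monidx n d -> k) -> iterpoly k d then
    fun c => \poly_(i < n.+1) monpoly (fun a => c (inord i, a))
  else fun c => c tt.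

Lemma ev_monpoly (B : comAlgType k) n d (z : nat -> B) (c : monidx n d -> k) :
  ev d z (monpoly c) = \sum_a c a *: mon z a.
Proof.
elim: d z c => [|d IHd] z c; first by rewrite (big_pred1 tt) => [|[]].
rewrite (@evS_sum _ _ _ _ _ n.+1) ?size_poly//.
transitivity (\sum_i \sum_a c (i, a) *: mon z ((i, a) : monidx n d.+1)); last first.
  by rewrite pair_bigA; apply: eq_bigr => -[].
apply: eq_bigr => i _; rewrite coef_poly ltn_ord inord_val IHd mulr_suml.
by apply: eq_bigr => a _; rewrite -scalerAl mulrC.
Qed.

Lemma monpoly_eq0 n d (c : monidx n d -> k) : monpoly c = 0 -> forall a, c a = 0.
Proof.
elim: d c => [c c0 [] //|d IHd c c0 [i a]].
have /IHd/(_ a) : monpoly (fun a => c (i, a)) = 0.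
  by have := congr1 (fun f : {poly _} => f`_i) c0; rewrite /= coef_poly ltn_ord
    inord_val coef0.
by [].
Qed.

Lemma free_mon (B : comAlgType k) n d (z : nat -> B) :
  injective (ev d z) -> free_fam (mon (n := n) (d := d) z).
Proof.
move=> zinj c c0; apply: monpoly_eq0; apply: zinj.
by rewrite ev_monpoly c0 rmorph0.
Qed.

(** Elements [x i] taken from the successive differences of a chain of primes
    are algebraically independent. Reading a polynomial from its terms of
    lowest degree in [x 0] up, a factor [x 0] can be cancelled modulo [P 0], and
    all terms but the constant one vanish modulo [P 1]. *)
Lemma chain_ev_notin (B : comAlgType k) d (P : nat -> prime_idealr B)
    (x : nat -> B) :
    (forall i, (i < d)%N -> [/\ {subset P i <= P i.+1}, x i \in P i.+1 &
       x i \notin P i]) ->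
  forall f : iterpoly k d, f != 0 -> ev d x f \notin P 0%N.
Proof.
elim: d P x => [|d IHd] P x Px f f0.
  apply/negP => /= fP.
  have : (f : k)^-1%:A * (f : k)%:A \in P 0%N by apply: idealMr.
  by rewrite mulr_algl scalerA mulVf// scale1r idealr1.
have {}IHd c : c != 0 -> ev d (fun i => x i.+1) c \notin P 1%N.
  by move=> c0; apply: (IHd (fun i => P i.+1)) => // i id; apply: Px.
have [P01 x1 x0] := Px 0%N isT.
elim/poly_ind: (f : {poly iterpoly k d}) f0 => [|g c IHg]; first by rewrite eqxx.
have evgc : ev d.+1 x (g * 'X + c%:P) =
    ev d.+1 x g * x 0%N + ev d (fun i => x i.+1) c.
  by rewrite !evS rmorphD rmorphM/= map_polyX map_polyC hornerMXaddC.
move=> gc0; rewrite evgc; have [c0|c0] := eqVneq c 0.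
  rewrite c0 rmorph0 addr0 prime_idealrM negb_or x0 andbT; apply: IHg.
  by apply: contraNneq gc0 => ->; rewrite c0 mul0r add0r polyC0.
apply: contra (IHd c c0) => /P01.
by rewrite rpredDl// idealMr.
Qed.

Lemma mon_filtered (B : comAlgType k) n d (x : nat -> B) (M : nat -> set B) :
    (forall m m', (m <= m')%N -> M m `<=` M m') ->
    (forall m i w, (i < d)%N -> M m w -> M m.+1 (x i * w)) ->
  forall (a : monidx n d) m w, M m w -> M (m + d * n)%N (mon x a * w).
Proof.
move=> Mle; elim: d x => [|d IHd] x Mx a m w Mw.
  by rewrite mul1r addn0.
have {IHd}Mw' := IHd (fun i => x i.+1) (fun m i w id => Mx m i.+1 w id) a.2 m w Mw.
have powM i : M (m + d * n + i)%N (x 0%N ^+ i * (mon (fun i => x i.+1) a.2 * w)).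
  elim: i => [|i IHi]; first by rewrite addn0 expr0 mul1r.
  by rewrite addnS exprS -mulrA; apply: Mx.
rewrite mulSn [(n + _)%N]addnC addnA -mulrA.
apply: Mle (powM a.1); rewrite leq_add2l; exact: (ltn_ord a.1).
Qed.

End Monomials.

Section CommutativeGrowth.
Variables (k : fieldType) (B : comAlgType k).

Definition growth_filtration (S : finType) (b : S -> B) (d : nat)
    (L : nat -> set B) (K : nat) : Prop :=
  [/\ forall n, is_subspace (L n), L 0%N 1, forall n, L n `<=` L n.+1,
      forall n s x, L n x -> L n.+1 (b s * x) &
      forall n, (0 < n)%N -> exists (T : finType) (y : T -> B),
        (#|T| <= K * n ^ d)%N /\ L n `<=` lspan (range y)].

(** If [B] is spanned by [g] over the polynomials in [d] elements [z], then
    multiplication by the [b s] raises the degrees of coefficients by a bounded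
    amount [e]. Hence products of length [n] of the [b s] have coefficients of
    partial degrees at most [(n + 1) e], and these form a space of dimension
    [O(n ^ d)]. *)
Lemma finite_over_growth d (z : nat -> B) (S : finType) (b : S -> B) :
    finite_over d z ->
  exists (L : nat -> set B) (K : nat), growth_filtration b d L K.
Proof.
move=> [T [g gP]].
have [c1 c1E] := gP 1.
have /choice[c cE] (st : S * T) : exists c : T -> iterpoly k d,
  b st.1 * g st.2 = \sum_t ev d z (c t) * g t by apply: gP.
have /choice[m1 m1P] t : exists n, bdeg n (c1 t) by apply: bdeg_ex.
have /choice[m mP] (q : S * T * T) : exists n, bdeg n (c q.1 q.2) by apply: bdeg_ex.
pose e := maxn (\max_t m1 t) (\max_q m q).
have c1e t : bdeg e (c1 t).
  by apply: bdeg_le (m1P t); rewrite leq_max (leq_bigmax t).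
have ce st t : bdeg e (c st t).
  by apply: bdeg_le (mP (st, t)); rewrite leq_max (leq_bigmax (st, t)) orbT.
pose L n := [set x | exists a : T -> iterpoly k d,
  (forall t, bdeg (n.+1 * e) (a t)) /\ x = \sum_t ev d z (a t) * g t].
exists L, (#|T| * (2 * e).+1 ^ d)%N; split.
- move=> n; split=> [|l _ _ [a [ba ->]] [a' [ba' ->]]].
    exists (fun=> 0); split=> [t|]; first exact: bdeg0.
    by rewrite big1// => t _; rewrite rmorph0 mul0r.
  exists (fun t => iterC k d l * a t + a' t); split=> [t|].
    by apply: bdegD => //; rewrite -[X in bdeg X _]add0n; apply: bdegM => //;
      apply: bdeg_const.
  rewrite scaler_sumr -big_split; apply: eq_bigr => t _ /=.
  by rewrite rmorphD rmorphM ev_iterC mulr_algl mulrDl scalerAl.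
- by exists c1; split=> // t; rewrite mul1n.
- move=> n _ [a [ba ->]]; exists a; split=> // t.
  by apply: bdeg_le (ba t); rewrite leq_mul2r leqnSn orbT.
- move=> n s _ [a [ba ->]]; exists (fun t => \sum_u a u * c (s, u) t); split=> [t|].
    by apply: bdeg_sum => u _; rewrite mulSn addnC; apply: bdegM.
  rewrite mulr_sumr; under eq_bigr do rewrite mulrCA (cE (s, _)) mulr_sumr.
  rewrite exchange_big; apply: eq_bigr => t _ /=.
  by rewrite rmorph_sum mulr_suml; apply: eq_bigr => u _; rewrite rmorphM mulrA.
move=> n n0; exists (T * monidx (n.+1 * e) d)%type, (fun ta => mon z ta.2 * g ta.1).
split.
  have leX i j l : (i <= j -> i ^ l <= j ^ l)%N by case: l => // l; rewrite leq_exp2r.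
  rewrite card_prod card_monidx -mulnA -expnMn leq_mul2l leX ?orbT//.
  apply: (@leq_trans (n.+1 * e + n)); first by rewrite -addn1 leq_add2l.
  rewrite [leqRHS]mulSn addnC leq_add2l (mulnC 2%N) -mulnA mulnC leq_mul2l mul2n -addnn.
  by rewrite -addn1 leq_add2l n0 orbT.
move=> _ [a [ba ->]]; apply: subspace_sum => [|t _]; first exact: is_subspace_lspan.
have /lspan_rangeP[l ->] := ev_bdeg z (ba t).
rewrite mulr_suml; apply: subspace_sum => [|u _]; first exact: is_subspace_lspan.
rewrite -scalerAl; apply: subspaceZ; first exact: is_subspace_lspan.
by apply: sub_lspan; exists (t, u).
Qed.

End CommutativeGrowth.

(** * Growth exponents as superior limits *)

Section GrowthExponents.
Variable R : realType.

Lemma limn_esup_le_near (u v : nat -> \bar R) :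
  (\forall n \near \oo, (u n <= v n)%E) -> (limn_esup u <= limn_esup v)%E.
Proof.
move=> [N _ uv]; rewrite !limn_esup_lim; apply: lee_lim.
- exact: is_cvg_esups.
- exact: is_cvg_esups.
exists N => // n /= Nn; apply: ge_ereal_sup => _ [p /= np <-].
apply: (@le_trans _ _ (v p)); first by apply: uv; apply: leq_trans np.
by apply: ereal_sup_ubound; exists p.
Qed.

Lemma cvg_ln_natr : ln (n%:R : R) @[n --> \oo] --> +oo.
Proof.
apply/cvgryPge => A.
have /cvgryPge/(_ (expR A)) := @cvgr_idn R; apply: filterS => n An.
by rewrite -[A]expRK ler_ln ?posrE ?expR_gt0// (lt_le_trans (expR_gt0 A)).
Qed.

(** A constant factor in the growth function adds [c / ln n] to the exponent,
    which does not change the limit. *)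
Lemma limn_esup_perturbed d (c : R) :
  limn_esup (fun n => (d%:R + c / ln n%:R)%:E) = (d%:R)%:E.
Proof.
apply: (@cvg_limn_einf_sup R _ (d%:R)%:E _).2.
apply: cvg_EFin; first exact: nearW.
rewrite -[X in _ --> X]addr0; apply: cvgD; first exact: cvg_cst.
rewrite -(mulr0 c); apply: cvgM; first exact: cvg_cst.
apply/gtr0_cvgV0; last exact: cvg_ln_natr.
by exists 2%N => // n /= n2; rewrite ln_gt0// ltr1n.
Qed.

Lemma limn_esup_le_growth (a : nat -> nat) d K :
  (forall n, (0 < n)%N -> (a n <= K * n ^ d)%N) ->
  (limn_esup (fun n => (ln (a n)%:R / ln n%:R : R)%:E) <= (d%:R)%:E)%E.
Proof.
move=> aK; rewrite -(limn_esup_perturbed d (ln K.+1%:R)).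
apply: limn_esup_le_near; exists 2%N => // n /= n2; rewrite lee_fin.
have lnn0 : 0 < ln n%:R :> R by rewrite ln_gt0// ltr1n.
have np : (0 < n)%N by apply: leq_trans n2.
have n0 : 0 < n%:R :> R by rewrite ltr0n.
rewrite ler_pdivrMr// mulrDl divfK ?gt_eqF// mulr_natl -lnXn// addrC.
rewrite -lnM ?posrE ?exprn_gt0//.
have [->|a0] := posnP (a n).
  rewrite ln0// ln_ge0// -natrX -natrM ler1n muln_gt0 expn_gt0.
  by rewrite np.
rewrite ler_ln ?posrE ?mulr_gt0 ?exprn_gt0 ?ltr0n//.
rewrite -natrX -natrM ler_nat (leq_trans (aK n np))//.
by rewrite leq_mul2r leqnSn orbT.
Qed.

Lemma limn_esup_ge_growth (a : nat -> nat) d K :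
  (forall n, (n ^ d <= K * a n)%N) ->
  ((d%:R)%:E <= limn_esup (fun n => (ln (a n)%:R / ln n%:R : R)%:E))%E.
Proof.
move=> aK; rewrite -(limn_esup_perturbed d (- ln K%:R)).
apply: limn_esup_le_near; exists 2%N => // n /= n2; rewrite lee_fin.
have lnn0 : 0 < ln n%:R :> R by rewrite ln_gt0// ltr1n.
have n0 : (0 < n)%N by apply: leq_trans n2.
have : (0 < K * a n)%N by apply: leq_trans (aK n); rewrite expn_gt0 n0.
rewrite muln_gt0 => /andP[K0 a0].
rewrite ler_pdivlMr// mulrDl divfK ?gt_eqF// mulr_natl -lnXn ?ltr0n//.
rewrite lerBlDr addrC -lnM ?posrE ?ltr0n//.
by rewrite ler_ln ?posrE ?mulr_gt0 ?exprn_gt0 ?ltr0n// -natrX -natrM ler_nat.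
Qed.

End GrowthExponents.

Section GKdimBounds.
Variables (R : realType) (k : fieldType) (A : algType k).

Lemma GKdim_le (M : \bar R) :
    (forall V : set A, (exists d, has_dim V d) -> exists K d,
      ((d%:R)%:E <= M)%E /\
      forall n, (0 < n)%N -> (Defs.dim (power_sum V n) <= K * n ^ d)%N) ->
  (GKdim R A <= M)%E.
Proof.
move=> AM; apply: ge_ereal_sup => _ [V /AM[K [d [dM VK]]] <-].
exact: le_trans (limn_esup_le_growth R VK) dM.
Qed.

Lemma le_GKdim (V : set A) d e K : has_dim V e ->
  (forall n, (n ^ d <= K * Defs.dim (power_sum V n))%N) ->
  ((d%:R)%:E <= GKdim R A)%E.
Proof.
move=> Ve VK; apply: le_trans (limn_esup_ge_growth R VK) _.
by apply: ereal_sup_ubound; exists V => //; exists e.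
Qed.

End GKdimBounds.

(** * Matrix representations and Gelfand-Kirillov dimension *)

Section PowerSums.
Variables (k : fieldType) (A : algType k).
Implicit Types V W : set A.

(** As [dim] is 0 on spaces of infinite dimension, an upper bound on it needs no
    finiteness. *)
Lemma dim_le (L : lmodType k) (W : set L) N :
  (forall d, has_dim W d -> (d <= N)%N) -> (Defs.dim W <= N)%N.
Proof.
move=> WN; have [[d Wd]|Wno] := pselect (exists d, has_dim W d).
  by rewrite (dimE Wd); apply: WN.
by rewrite /Defs.dim xgetPN// => d Wd; apply: Wno; exists d.
Qed.

Lemma is_subspace_power_sum V n : is_subspace (power_sum V n).
Proof. exact: is_subspace_lspan. Qed.

Lemma power_sumW V W n : is_subspace W ->
  (forall s : seq A, (size s <= n)%N -> (forall y, y \in s -> V y) ->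
     W (\prod_(y <- s) y)) ->
  power_sum V n `<=` W.
Proof. by move=> sW VW; apply: lspan_min => // _ [s [sn sV] <-]; apply: VW. Qed.

Lemma power_sum_le V n m : (n <= m)%N -> power_sum V n `<=` power_sum V m.
Proof.
move=> nm; apply: power_sumW => [|s sn sV]; first exact: is_subspace_lspan.
by apply: sub_lspan; exists s; split=> //; apply: leq_trans nm.
Qed.

Lemma power_sum1 V n : power_sum V n 1.
Proof. by apply: sub_lspan; exists [::]; [|rewrite big_nil]. Qed.

Lemma power_sumMr V n x y : power_sum V n x -> V y -> power_sum V n.+1 (x * y).
Proof.
move=> Vx Vy; move: x Vx.
apply: (@power_sumW V [set x | power_sum V n.+1 (x * y)]) => [|s sn sV].
  have [V0 VD] := is_subspace_power_sum V n.+1.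
  split=> [|c u v] /=; first by rewrite mul0r.
  by rewrite mulrDl -scalerAl; apply: VD.
apply: sub_lspan; exists (rcons s y); last first.
  by rewrite -cats1 big_cat big_seq1.
split=> [|z]; first by rewrite size_rcons.
by rewrite mem_rcons inE => /predU1P[->//|/sV].
Qed.

(** A lower bound on [dim], by contrast, requires finite dimension. *)
Lemma power_sum_fin (T : finType) (b : T -> A) n :
  exists (S : finType) (y : S -> A),
    power_sum (lspan (range b)) n `<=` lspan (range y).
Proof.
suff [S [y yP]] : exists (S : finType) (y : S -> A), forall s : seq A,
    (size s <= n)%N -> (forall y, y \in s -> lspan (range b) y) ->
    lspan (range y) (\prod_(y <- s) y).
  exists S, y; apply: (@power_sumW _ (lspan (range y))) => //.
  exact: is_subspace_lspan.
elim: n => [|n [S [y yP]]].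
  exists unit, (fun=> 1) => -[_ _|//]; rewrite big_nil.
  by apply: sub_lspan; exists tt.
exists (option (T * S)), (fun o => if o is Some ts then b ts.1 * y ts.2 else 1).
move=> [_ _|x s]; first by rewrite big_nil; apply: sub_lspan; exists None.
move=> sn sV; rewrite big_cons.
have /lspan_rangeP[c ->] : lspan (range b) x by apply: sV; rewrite mem_head.
have /lspan_rangeP[l ->] : lspan (range y) (\prod_(y <- s) y).
  by apply: yP => // z zs; apply: sV; rewrite in_cons zs orbT.
rewrite mulr_suml; apply: subspace_sum => [|t _]; first exact: is_subspace_lspan.
rewrite mulr_sumr; apply: subspace_sum => [|u _]; first exact: is_subspace_lspan.
rewrite -scalerAl -scalerAr; do 2![apply: subspaceZ; first exact: is_subspace_lspan].
by apply: sub_lspan; exists (Some (t, u)).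
Qed.

End PowerSums.

Section MatrixRepresentations.
Variables (R : realType) (k : fieldType) (A : algType k).

Definition matrix_rep (B : comAlgType k) r (Phi : A -> 'M[B]_r) : Prop :=
  [/\ forall (c : k) a b, Phi (c *: a + b) = c%:A *: Phi a + Phi b,
      Phi 1 = 1%:M & forall a b, Phi (a * b) = Phi a *m Phi b].

Lemma linear_entry (B : comAlgType k) r (Phi : A -> 'M[B]_r) u v :
  matrix_rep Phi -> linear (fun a => Phi a u v).
Proof. by move=> [PL _ _] c a b; rewrite PL !mxE mulr_algl. Qed.

(** The entries of a product of [n] elements of a finite-dimensional space [V]
    are combinations of products of length [n] of finitely many elements of the
    algebras [B j], whose growth is controlled by Noether normalization. *)
Lemma GKdim_le_Kdim (J : finType) (B : J -> comAlgType k) (r : J -> nat)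
    (Phi : forall j, A -> 'M[B j]_(r j)) (M : \bar R) :
    (forall j, matrix_rep (Phi j)) ->
    (forall a, (forall j, Phi j a = 0) -> a = 0) ->
    (forall j, affine_algebra (B j)) -> (forall j, (Kdim R (B j) <= M)%E) ->
  (GKdim R A <= M)%E.
Proof.
move=> Prep Pinj Baff BM; apply: GKdim_le => V [p [a [_ ->]]].
have [j1 _] : exists j1 : J, true.
  apply: contrapT => noJ; have /eqP := oner_neq0 A; case.
  by apply: Pinj => j; case: noJ; exists j.
pose b j (s : 'I_p * ('I_(r j) * 'I_(r j))) : B j := Phi j (a s.1) s.2.1 s.2.2.
have growth j : exists d (L : nat -> set (B j)) (K : nat),
    ((d%:R)%:E <= M)%E /\ growth_filtration (b j) d L K.
  have [d [z [zinj zfin]]] := noether_normalization (Baff j).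
  have [L [K LK]] := finite_over_growth (b j) zfin.
  exists d, L, K; split => //.
  exact: le_trans (finite_over_le_Kdim R zinj zfin) (BM j).
have [d Lex] := choice growth.
pose L j := sval (cid (Lex j)).
have /choice[K LK] j : exists K : nat,
    ((d j)%:R%:E <= M)%E /\ growth_filtration (b j) (d j) (L j) K.
  exact: svalP (cid (Lex j)).
have entry j s u v : (forall y, y \in s -> lspan (range a) y) ->
    L j (size s) (Phi j (\prod_(y <- s) y) u v).
  have [_ [Lsub L1 _ LM _]] := LK j; have [_ P1 PM] := Prep j.
  elim: s u v => [|y s IHs] u v sV.
    rewrite big_nil P1 mxE; case: eqP => _; first exact: L1.
    by case: (Lsub 0%N).
  have /lspan_rangeP[c yE] : lspan (range a) y by apply: sV; rewrite mem_head.
  rewrite big_cons PM mxE; apply: subspace_sum => // w _.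
  have -> : Phi j y u w = \sum_i c i *: b j (i, (u, w)).
    by rewrite yE; apply: (linear_comb c a (linear_entry u w (Prep j))).
  rewrite mulr_suml.
  apply: subspace_sum => // i _; rewrite -scalerAl; apply: subspaceZ => //.
  apply: LM; apply: IHs => x xs.
  by apply: sV; rewrite in_cons xs orbT.
have [j0 _ dmax] := @arg_maxnP J j1 xpredT d isT.
exists (\sum_(q : {j : J & 'I_(r j) * 'I_(r j)}%type) K (tag q))%N, (d j0).
split=> [|n n0]; first by have [] := LK j0.
apply: dim_le => e [x [xfree xV]].
have Lbasis j : exists (T : finType) (y : T -> B j),
    (#|T| <= K j * n ^ d j)%N /\ L j n `<=` lspan (range y).
  by have [_ [_ _ _ _ +]] := LK j; apply.
have [T Ty] := choice Lbasis.
pose y j := sval (cid (Ty j)).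
have yP j : (#|T j| <= K j * n ^ d j)%N /\ L j n `<=` lspan (range (y j)).
  exact: svalP (cid (Ty j)).
have Wentry a' j u v : power_sum (lspan (range a)) n a' ->
    L j n (Phi j a' u v).
  have [_ [Lsub _ Lmono _ _]] := LK j.
  move: a'; apply: (@power_sumW _ _ _ [set a' | L j n (Phi j a' u v)]).
    have [L0 LD] := Lsub n; split=> [|c x1 x2 Lx1 Lx2] /=.
      by rewrite (linear_at0 (linear_entry u v (Prep j))).
    by rewrite linear_entry//; apply: LD.
  move=> s sn sV; move: (entry j s u v sV); rewrite -(subnK sn) /=.
  by elim: (n - _)%N => // i IHi /IHi; apply: Lmono.
have := @card_free_le k A 'I_e {j : J & 'I_(r j) * 'I_(r j)}%type x
  (fun q => B (tag q)) (fun q x => Phi (tag q) x (tagged q).1 (tagged q).2)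
  (fun q => T (tag q)) (fun q => y (tag q)) xfree.
rewrite card_ord => /(_ _ _ _)/leq_trans; apply.
- by move=> q; apply: linear_entry.
- move=> w w0; apply: Pinj => j; apply/matrixP => u v; rewrite mxE.
  exact: (w0 (Tagged (fun j => 'I_(r j) * 'I_(r j))%type (u, v))).
- move=> s q; apply: (yP _).2; apply: Wentry; rewrite xV.
  by apply: sub_lspan; exists s.
rewrite big_distrl; apply: leq_sum => q _ /=.
apply: leq_trans (yP _).1 _; rewrite leq_mul2l leq_pexp2l ?orbT//.
exact: dmax.
Qed.

(** Let [x i] come from a chain of primes of [B], so that their monomials are
    independent. Multiplication by [x i] on the generators [g] is expressed
    through finitely many elements of [A]; they span [V]. A monomial of degree
    [n] then maps each generator into the sum of the [V ^ n g t], and it is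
    determined by the images of the generators, because these generate a
    faithful [B]-module. *)
Lemma Kdim_le_GKdim (B : comAlgType k) r (Phi : A -> 'M[B]_r) s
    (g : 'I_s -> 'M[B]_r) :
    matrix_rep Phi -> (0 < r)%N ->
    (forall X, exists a : 'I_s -> A, X = \sum_t Phi (a t) *m g t) ->
  (Kdim R B <= GKdim R A)%E.
Proof.
move=> Prep r0 gP; have [PL P1 PM] := Prep.
apply: ge_ereal_sup => _ [d [P Plt] <-].
pose Q i := P (inord i : 'I_d.+1).
have /choice[x xP] i : exists x, (i < d)%N -> x \in Q i.+1 /\ x \notin Q i.
  have [id|] := ltnP i d; last by exists 0.
  have [|_ nsub] := Plt (inord i) (inord i.+1).
    by rewrite !inordK ?ltnS ?(ltnW id).
  apply: contrapT => nox; apply: nsub => y yQ; apply: contrapT => /negP yQ'.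
  by case: nox; exists y.
have Qx i : (i < d)%N -> [/\ {subset Q i <= Q i.+1}, x i \in Q i.+1 & x i \notin Q i].
  move=> id; have [xQ xQ'] := xP i id; split=> //.
  have [|//] := Plt (inord i) (inord i.+1).
  by rewrite !inordK ?ltnS ?(ltnW id).
have xinj : injective (ev d x).
  move=> f h /eqP; rewrite -subr_eq0 -rmorphB => /eqP fh0.
  apply/eqP; rewrite -subr_eq0; apply: contrapT => /negP fh.
  by have := chain_ev_notin Qx fh; rewrite fh0 rpred0.
have /choice[c cE] (q : 'I_d * 'I_s) : exists a : 'I_s -> A,
  x q.1 *: g q.2 = \sum_t Phi (a t) *m g t by apply: gP.
pose b (q : 'I_d * 'I_s * 'I_s) := c q.1 q.2.
pose V := lspan (range b).
have [e Ve] := has_dim_range b.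
pose M n := [set w : B | forall t, exists v : 'I_s -> A,
  (forall u, power_sum V n (v u)) /\ w *: g t = \sum_u Phi (v u) *m g u].
have Mmono n n' : (n <= n')%N -> M n `<=` M n'.
  move=> nn' w Mw t; have [v [vV wE]] := Mw t; exists v; split=> // u.
  by apply: power_sum_le (vV u).
have P0 : Phi 0 = 0.
  by apply/matrixP => u v; rewrite (linear_at0 (linear_entry u v Prep)) mxE.
have M1 : M 0%N 1.
  move=> t; exists (fun u => if u == t then 1 else 0); split=> [u|].
    case: eqP => _; first exact: power_sum1.
    by case: (is_subspace_power_sum V 0).
  rewrite (bigD1 t)//= eqxx P1 mul1mx scale1r big1 ?addr0// => u /negbTE->.
  by rewrite P0 mul0mx.
have PD (v : 'I_s -> A) : Phi (\sum_t v t) = \sum_t Phi (v t).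
  apply: (big_ind2 (fun a X => Phi a = X)) => // a1 X1 a2 X2 <- <-.
  by rewrite -[a1]scale1r PL !scale1r.
have Mstep n i w : (i < d)%N -> M n w -> M n.+1 (x i * w).
  move=> id Mw t; have [v [vV wE]] := Mw t.
  exists (fun u => \sum_t v t * c (Ordinal id, t) u); split=> [u|].
    apply: subspace_sum => [|t' _]; first exact: is_subspace_power_sum.
    apply: power_sumMr => //; apply: sub_lspan.
    by exists (Ordinal id, t', u).
  rewrite -scalerA wE scaler_sumr.
  under eq_bigr do rewrite scalemxAr (cE (Ordinal id, _)) mulmx_sumr.
  rewrite exchange_big; apply: eq_bigr => u _; rewrite PD mulmx_suml.
  by apply: eq_bigr => t' _; rewrite PM mulmxA.
have faithful w : (forall t, w *: g t = 0) -> w = 0.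
  move=> wg; have [a aE] := gP 1%:M.
  have : w *: (1%:M : 'M[B]_r) = 0.
    rewrite aE scaler_sumr big1// => t _.
    by rewrite scalemxAr wg mulmx0.
  move=> /matrixP/(_ (Ordinal r0) (Ordinal r0)).
  by rewrite !mxE eqxx mulr1.
apply: (@le_GKdim R k A V d e (d ^ d * (s * (r * r) * s))%N Ve) => N.
have [D VD] : exists D, has_dim (power_sum V N) D.
  have [S [y yP]] := power_sum_fin b N.
  exact: has_dim_fin (is_subspace_power_sum V N) yP.
rewrite (dimE VD); have [y [_ yE]] := VD.
(* The monomials with exponents up to [N %/ d] have total degree at most [N],
   and [N ^ d <= d ^ d * (N %/ d).+1 ^ d]. *)
have := @card_free_le k B (monidx (N %/ d) d) ('I_s * ('I_r * 'I_r))%type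
  (mon x) (fun=> B) (fun q w => w * g q.1 q.2.1 q.2.2)
  (fun=> 'I_D * 'I_s)%type
  (fun q et => (Phi (y et.1) *m g et.2) q.2.1 q.2.2) (free_mon xinj).
rewrite card_monidx sum_nat_const !card_prod !card_ord => /(_ _ _ _) count.
have {}count : ((N %/ d).+1 ^ d <= s * (r * r) * (D * s))%N.
  apply: count => [q c1 w1 w2|w w0|a q].
  - by rewrite mulrDl scalerAl.
  - apply: faithful => t; apply/matrixP => u v; rewrite !mxE.
    exact: (w0 (t, (u, v))).
  have Ma : M N (mon x a).
    have := mon_filtered Mmono Mstep a M1; rewrite add0n mulr1.
    by apply: Mmono; rewrite mulnC leq_trunc_div.
  have [v [vV wE]] := Ma q.1.
  have -> : mon x a * g q.1 q.2.1 q.2.2 = (mon x a *: g q.1) q.2.1 q.2.2.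
    by rewrite mxE.
  rewrite wE summxE; apply: subspace_sum => [|t _]; first exact: is_subspace_lspan.
  have /lspan_rangeP[l ->] : lspan (range y) (v t) by rewrite -yE; apply: vV.
  have -> : (Phi (\sum_i l i *: y i) *m g t) q.2.1 q.2.2 =
      \sum_i l i *: (Phi (y i) *m g t) q.2.1 q.2.2.
    apply: (linear_comb l y (f := fun a => (Phi a *m g t) q.2.1 q.2.2)).
    by move=> c1 a1 a2; rewrite PL mulmxDl -scalemxAl !mxE mulr_algl.
  apply: subspace_sum => [|i _]; first exact: is_subspace_lspan.
  apply: subspaceZ; first exact: is_subspace_lspan.
  by apply: sub_lspan; exists (i, t).
have leX i j l : (i <= j -> i ^ l <= j ^ l)%N by case: l => // l; rewrite leq_exp2r.
apply: (@leq_trans ((d * (N %/ d).+1) ^ d)%N).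
  case: (posnP d) => [->|d0] //; apply: leX.
  by rewrite mulnC ltnW// ltn_ceil.
by rewrite expnMn -mulnA leq_mul2l -mulnA (mulnC s D) count orbT.
Qed.

End MatrixRepresentations.

(** * Representations on the cell bimodules *)

Section CellRepresentation.
Variables (k : fieldType) (A : algType k) (i : A -> A) (J : set A).
Variable D : affine_cell_ideal i J.

Local Notation B := (cell_alg D).
Local Notation r := (cell_rank D).
Local Notation alpha := (@cell_alpha _ _ _ _ D).

Definition cell_rep (a : A) : 'M[B]_r :=
  \matrix_(s, t) @cell_act _ _ _ _ D a (delta_mx t 0) s 0.

Lemma cell_actE a (x : 'cV[B]_r) : @cell_act _ _ _ _ D a x = cell_rep a *m x.
Proof.
have [_ _ _ actD] := cell_actP D.
have act0 := act0 a (cell_actP D).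
have -> : x = \sum_t x t 0 *: delta_mx t 0.
  apply/matrixP => s u; rewrite (ord1 u) summxE (bigD1 s)//= !mxE !eqxx mulr1.
  rewrite big1 ?addr0// => t ts; rewrite !mxE eq_sym (negbTE ts) mulr0//.
rewrite mulmx_sumr.
apply: (big_ind2 (fun x y => @cell_act _ _ _ _ D a x = y)) => // [x1 y1 x2 y2 <- <-|t _].
  by rewrite -[x1]scale1r actD !scale1r.
rewrite -[_ *: _]addr0 actD act0 !addr0 -scalemxAr; congr (_ *: _).
apply/matrixP => s u; rewrite (ord1 u) !mxE (bigD1 t)//= !mxE !eqxx mulr1.
by rewrite big1 ?addr0// => v vt; rewrite !mxE (negbTE vt) mulr0.
Qed.

Lemma cell_rep_matrix_rep : matrix_rep cell_rep.
Proof.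
have [act1 actM actL _] := cell_actP D.
split=> [c a b||a b]; apply/matrixP => s t.
- by rewrite !mxE actL !mxE.
- by rewrite !mxE act1 mxE eqxx andbT eq_sym.
rewrite mxE actM cell_actE mxE [RHS]mxE; apply: eq_bigr => u _.
by congr (_ * _); rewrite [RHS]mxE.
Qed.

Lemma cell_alphaM a x : J x -> alpha (a * x) = cell_rep a *m alpha x.
Proof.
move=> Jx; rewrite (cell_alphaMl D a Jx); apply/matrixP => s t.
by rewrite mxE cell_actE !mxE; apply: eq_bigr => u _; rewrite !mxE.
Qed.

Lemma cell_alpha0 : alpha 0 = 0.
Proof.
have [J0 _ _ _] := cell_ideal D.
have J0' : 0 \in J by rewrite inE.
by have := cell_alphaD D J0' J0'; rewrite addr0 => /eqP; rewrite -subr_eq0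
  opprD addrA subrr sub0r oppr_eq0 => /eqP.
Qed.

Lemma cell_alpha_eq0 x : J x -> alpha x = 0 -> x = 0.
Proof.
move=> Jx x0; have [_ inj _] := cell_alpha_bij D.
have [J0 _ _ _] := cell_ideal D.
by apply: inj; rewrite ?inE// x0 cell_alpha0.
Qed.

(** The kernel of the representation is the left annihilator of [J], which the
    involution exchanges with the right annihilator. *)
Lemma cell_rep_faithful : k_involution i -> r_ann J = [set 0] ->
  forall a, cell_rep a = 0 -> a = 0.
Proof.
move=> [ilin iM iK] annJ a a0.
have [_ _ JMl _] := cell_ideal D.
have aJ x : J x -> a * x = 0.
  move=> Jx; apply: cell_alpha_eq0; first exact: JMl.
  by rewrite cell_alphaM// a0 mul0mx.
have i0 : i 0 = 0 := linear_at0 ilin.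
have : r_ann J (i a).
  move=> y; rewrite -{1}(cell_inv D) => -[x Jx <-].
  by rewrite -iM aJ.
by rewrite annJ /= => /(congr1 i); rewrite iK i0.
Qed.

(** Inside [J] the representation is left multiplication by
    [alpha a *m psi], and [psi] is cancelled through its adjugate. *)
Lemma cell_rep_inj_layer (psi : 'M[B]_r) : cell_matrix D psi ->
  GRing.lreg (\det psi) -> forall a, J a -> cell_rep a = 0 -> a = 0.
Proof.
move=> psiP detpsi a Ja a0; apply: cell_alpha_eq0 => //.
have [_ _ surj] := cell_alpha_bij D.
have [e Je e1] := surj 1%:M I.
have : alpha a *m psi = 0.
  by rewrite -[LHS]mulmx1 -e1 -psiP// cell_alphaM// a0 mul0mx.
move=> /(congr1 (mulmx^~ (\adj psi))); rewrite /= mul0mx -mulmxA mul_mx_adj.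
move=> /matrixP apsi; apply/matrixP => s t; apply: detpsi.
by have := apsi s t; rewrite mul_mx_scalar !mxE mulr0.
Qed.

Lemma cell_rep_gen : fg_left_module J ->
  exists (s : nat) (g : 'I_s -> 'M[B]_r), forall X,
    exists a : 'I_s -> A, X = \sum_t cell_rep (a t) *m g t.
Proof.
move=> [s [g [Jg gP]]]; exists s, (fun t => alpha (g t)) => X.
have [_ _ surj] := cell_alpha_bij D.
have [J0 JB JMl _] := cell_ideal D.
have [x Jx <-] := surj X I.
have [a ->] := gP x Jx; exists a.
have JD u v : J u -> J v -> J (u + v).
  by move=> Ju Jv; rewrite -[v]opprK -[- v]sub0r; do 2!apply: (JB) => //.
suff [] : J (\sum_t a t * g t) /\
  alpha (\sum_t a t * g t) = \sum_t cell_rep (a t) *m alpha (g t) by [].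
apply: (big_ind2 (fun u v => J u /\ alpha u = v)) => [|u1 v1 u2 v2 [J1 <-] [J2 <-]|t _].
- by split=> //; apply: cell_alpha0.
- by split; [exact: JD|apply: (cell_alphaD D); rewrite inE].
- by split; [exact: JMl|exact: cell_alphaM].
Qed.

End CellRepresentation.

Section CellChain.
Variables (k : fieldType) (A : algType k) (i : A -> A) (i_inv : k_involution i).
Variables (n : nat) (C : cell_chain i n).

Lemma partial_sum_inv j a :
  partial_sum (chain_part C) j a -> partial_sum (chain_part C) j (i a).
Proof.
have [ilin _ _] := i_inv.
move=> [x [xP ->]]; exists (fun l => i (x l)); split=> [l|].
  by have := chain_part_inv C l => /seteqP[+ _]; apply; exists (x l) => //; apply: xP.
apply: (big_ind2 (fun u v => i u = v)) => //; first exact: linear_at0.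
by move=> u1 v1 u2 v2 <- <-; rewrite -[u1]scale1r ilin !scale1r.
Qed.

Lemma quotAlg_inv_k_involution j :
  k_involution (quotAlg_inv (I := chain_prev C j) i).
Proof.
have [ilin iM iK] := i_inv.
have iB : zmod_morphism i by move=> x y; rewrite addrC -scaleN1r ilin scaleN1r addrC.
pose i' : {additive A -> A} := HB.pack i (GRing.isZmodMorphism.Build A A i iB).
have iI y : in_ideal (chain_prev C j) y -> in_ideal (chain_prev C j) (i' y).
  by rewrite chain_prevE; apply: partial_sum_inv.
have iE x : quotAlg_inv i (quotAlg_pi (chain_prev C j) x) = quotAlg_pi _ (i x).
  exact: (quotAlg_invE (i := i') x iI).
split=> [c p q|p q|p].
- rewrite -[p]quotAlg_reprK -[q]quotAlg_reprK -quotAlg_piZ -quotAlg_piD !iE ilin.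
  by rewrite quotAlg_piD quotAlg_piZ.
- by rewrite -[p]quotAlg_reprK -[q]quotAlg_reprK -quotAlg_piM !iE iM quotAlg_piM.
- by rewrite -[p]quotAlg_reprK !iE iK.
Qed.

Definition chain_rep j (a : A) : 'M[chain_B C j]_(chain_rank C j) :=
  cell_rep (chain_cell C j) (quotAlg_pi (chain_prev C j) a).

Lemma chain_rep_matrix_rep j : matrix_rep (chain_rep j).
Proof.
have [PL P1 PM] := cell_rep_matrix_rep (chain_cell C j).
split=> [c a b||a b]; rewrite /chain_rep.
- by rewrite quotAlg_piD quotAlg_piZ PL.
- exact: P1.
- by rewrite quotAlg_piM PM.
Qed.

(** An element killed by all representations up to [m] descends the chain: it
    lies in J_(m-1) since the representation of A / J_(m-1) is faithful, and
    from J_l it passes to J_(l-1) since the representation of A / J_(l-1) is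
    injective on J_l / J_(l-1). *)
Lemma chain_rep_jointly_inj (m : 'I_n.+1)
    (psi : forall j : 'I_n.+1, 'M[chain_B C j]_(chain_rank C j)) :
    (forall j, cell_matrix (chain_cell C j) (psi j)) ->
    (forall j, GRing.lreg (\det (psi j))) ->
    r_ann (chain_layer C m) = [set 0] ->
  forall a, (forall j : 'I_n.+1, (j <= m)%N -> chain_rep j a = 0) -> a = 0.
Proof.
move=> psiP detpsi annm a a0.
have pi0 (j : 'I_n.+1) : quotAlg_pi (chain_prev C j) a = 0 ->
    partial_sum (chain_part C) j a.
  by rewrite -(quotAlg_pi0 (chain_prev C j)) => /quotAlg_piP; rewrite subr0 chain_prevE.
have am : partial_sum (chain_part C) m a.
  apply/pi0; apply: cell_rep_faithful (a0 m (leqnn m)) => //.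
  exact: quotAlg_inv_k_involution.
suff /(_ m (leqnn m)) : forall l, (l <= m)%N -> partial_sum (chain_part C) (m - l) a.
  by rewrite subnn => -[x [_ ->]]; rewrite big_pred0.
elim=> [_|l IHl lm]; first by rewrite subn0.
have jn : (m - l.+1 < n.+1)%N by rewrite (leq_ltn_trans (leq_subr _ _)).
pose j := Ordinal jn.
have jS : (m - l = j.+1)%N by rewrite /= -subSn// subSS.
apply: (pi0 j); apply: (cell_rep_inj_layer (psiP j) (detpsi j)).
  by exists a => //; rewrite -jS; apply/IHl/ltnW.
by apply: a0; apply: leq_subr.
Qed.

End CellChain.

Theorem corollary4p5 (R : realType) (k : fieldType) (A : algType k)
  (i : A -> A) (i_inv : k_involution i) (n : nat) (C : cell_chain i n)
  (psi : forall j : 'I_n.+1, 'M[chain_B C j]_(chain_rank C j))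
  (psiP : forall j : 'I_n.+1, cell_matrix (chain_cell C j) (psi j))
  (B_reduced : forall j : 'I_n.+1, reduced (chain_B C j))
  (det_regular : forall j : 'I_n.+1, GRing.lreg (\det (psi j)))
  (m : 'I_n.+1)
  (r_ann_m : r_ann (chain_layer C m) = [set 0])
  (m_least : forall l : 'I_n.+1, (l < m)%N ->
    r_ann (chain_layer C l) <> [set 0]) :
  (GKdim R A <= \big[maxe/-oo]_(j < n.+1 | (j <= m)%N) Kdim R (chain_B C j))%E
  /\
  ((forall l : 'I_n.+1, (l <= m)%N -> fg_left_module (chain_layer C l)) ->
   GKdim R A = \big[maxe/-oo%E]_(j < n.+1 | (j <= m)%N) Kdim R (chain_B C j)).
Proof.
have upper : (GKdim R A <=
    \big[maxe/-oo]_(j < n.+1 | (j <= m)%N) Kdim R (chain_B C j))%E.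
  pose w : 'I_m.+1 -> 'I_n.+1 := widen_ord (ltn_ord m).
  apply: (@GKdim_le_Kdim R k A 'I_m.+1 (fun j => chain_B C (w j))
    (fun j => chain_rank C (w j)) (fun j => chain_rep C (w j))).
  - by move=> j; apply: chain_rep_matrix_rep.
  - move=> a a0; apply: (chain_rep_jointly_inj i_inv psiP det_regular r_ann_m).
    move=> j jm; have -> : j = w (Ordinal (jm : (j < m.+1)%N)) by apply: val_inj.
    exact: a0.
  - by move=> j; apply: cell_affine.
  - move=> j; apply: (@le_bigmax_cond _ _ _ _ _ (fun j : 'I_n.+1 => (j <= m)%N)).
    by rewrite /= -ltnS.
split=> // fg; apply: le_anti; rewrite upper /=.
apply: bigmax_le => [|j jm]; first exact: leNye.
have [s [g gP]] := cell_rep_gen (chain_cell C j) (fg j jm).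
apply: (@Kdim_le_GKdim R k A _ _ (chain_rep C j) s g).
- exact: chain_rep_matrix_rep.
- exact: cell_rank_gt0.
move=> X; have [a ->] := gP X; exists (fun t => quotAlg_repr (a t)).
by apply: eq_bigr => t _; rewrite /chain_rep quotAlg_reprK.
Qed.
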